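(* Let $(V,E)$ be a filtered vertex algebra over $\mathbb{C}$, that is, a vertex algebra $V$ over $\mathbb{C}$ equipped with a good filtration $E=\{E_n\}$. For $n\ge0$ let $U_n$ be a subspace of $E_n$ such that $E_n=U_n\oplus E_{n-1}$, so that $$V=U_0\oplus U_1\oplus\cdots=\coprod_{n\ge0}U_n.$$ For $n\ge0$, denote by $p_n$ the projection map of $V$ onto $U_n$. Set $V_E[h]=V[h]=\mathbb{C}[h]\otimes V$ as a $\mathbb{C}[h]$-module, which is free. For $u\in U_m$, $v\in U_n$ define $$Y_h(u,x)v=\sum_{j=0}^{m+n}h^{m+n-j}p_j(Y(u,x)v)=\sum_{r\in\mathbb{Z}}\sum_{j=0}^{m+n}h^{m+n-j}p_j(u_rv)x^{-r-1},$$ and then extend the definition $\mathbb{C}[h]$-linearly to $V_E[h]$. Then $(V_E[h],Y_h,\mathbf{1})$ carries the structure of a vertex algebra over $\mathbb{C}[h]$ such that $V_E[h]/hV_E[h]$ is commutative. Furthermore, the linear map $$\psi:V\to V_E[h]/(h-1)V_E[h],\qquad v\mapsto v+(h-1)V_E[h]$$ is a vertex algebra isomorphism over $\mathbb{C}$, and the linear map $$\phi:\mathrm{gr}_EV=\coprod_{m\ge0}E_m/E_{m-1}\to V_E[h]/hV_E[h],\qquad v+E_{m-1}\in E_m/E_{m-1}\mapsto p_m(v)+hV_E[h]$$ is a vertex Poisson algebra isomorphism over $\mathbb{C}$.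
   Context: Vertex algebra over a unital commutative $\mathbb{C}$-algebra $K$: a $K$-module $V$ with a $K$-linear map $Y:V\to\mathrm{Hom}_K(V,V((x)))$, $v\mapsto Y(v,x)=\sum_{n\in\mathbb{Z}}v_nx^{-n-1}$, and $\mathbf{1}\in V$ such that $Y(\mathbf{1},x)=\mathrm{id}$; $Y(v,x)\mathbf{1}\in V[[x]]$ with $v_{-1}\mathbf{1}=v$; and for $u,v\in V$ $$x_0^{-1}\delta\left(\tfrac{x_1-x_2}{x_0}\right)Y(u,x_1)Y(v,x_2)-x_0^{-1}\delta\left(\tfrac{x_2-x_1}{-x_0}\right)Y(v,x_2)Y(u,x_1)=x_2^{-1}\delta\left(\tfrac{x_1-x_0}{x_2}\right)Y(Y(u,x_0)v,x_2),$$ where $\delta(x)=\sum_{n\in\mathbb{Z}}x^n$ and powers of binomials are expanded in nonnegative powers of the second variable. Put $\mathcal{D}v=v_{-2}\mathbf{1}$. $V$ is commutative if $[Y(u,x_1),Y(v,x_2)]=0$ for all $u,v$, equivalently $u_nv=0$ for all $u,v$ and $n\ge0$. Good filtration of $V$: an increasing family of subspaces $E_n$ ($n\in\mathbb{Z}$) with $\bigcup_{n\in\mathbb{Z}}E_n=V$, $\mathbf{1}\in E_0$, and for $u\in E_m$, $v\in E_n$: $u_jv\in E_{m+n}$ for $j<0$, $u_jv\in E_{m+n-1}$ for $j\ge0$. Vertex Lie algebra: a vector space $A$ with a linear operator $\partial$ and bilinear products $(a,b)\mapsto a_nb$ ($n\in\mathbb{N}=\{0,1,2,\dots\}$) such that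 for $a,b,c\in A$, $m,n\in\mathbb{N}$: (C0) $a_nb=0$ for $n$ sufficiently large; (C1) $(\partial a)_nb=-n\,a_{n-1}b$ (which is $0$ for $n=0$); (C2) $a_nb=\sum_{i\ge0}(-1)^{n+i+1}\frac{1}{i!}\partial^i(b_{n+i}a)$; (C3) $a_mb_nc-b_na_mc=\sum_{i=0}^m\binom{m}{i}(a_ib)_{m+n-i}c$. Vertex Poisson algebra: a unital commutative associative algebra $A$ with a derivation $\partial$ and a vertex Lie algebra structure with the same $\partial$ such that each $a_n$ ($a\in A$, $n\ge0$) is a derivation of $A$. An isomorphism of vertex Poisson algebras is a bijective algebra homomorphism commuting with $\partial$ and preserving all products $a_nb$, $n\ge0$. For a filtered vertex algebra $(V,E)$, the associated graded space $\mathrm{gr}_EV=\coprod_{n\in\mathbb{Z}}E_n/E_{n-1}$ is a vertex Poisson algebra with, for $u\in E_m$, $v\in E_n$, $i\ge0$: $(u+E_{m-1})(v+E_{n-1})=u_{-1}v+E_{m+n-1}$, $\partial(u+E_{m-1})=\mathcal{D}u+E_{m-1}$, $(u+E_{m-1})_i(v+E_{n-1})=u_iv+E_{m+n-2}$. If $W$ is a vertex algebra over $\mathbb{C}[h]$ with $\ker_Wh\subset hW$ and $W/hW$ commutative, then $W/hW$ is a vertex Poisson algebra over $\mathbb{C}$ with $(u+hW)\cdot(v+hW)=u_{-1}v+hW$, $\partial(u+hW)=u_{-2}\mathbf{1}+hW$, and $(u+hW)_i(v+hW)=\frac1h u_iv+hW$ for $i\ge0$ (where $\frac1hu_iv$ denotes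 any $w\in W$ with $hw=u_iv$). This is the vertex Poisson structure on $V_E[h]/hV_E[h]$.
   Formalization: The good filtration is additionally assumed to satisfy E_n = 0 for n < 0; given the complements U_n this is equivalent to the asserted V = U_0 ⊕ U_1 ⊕ ⋯, which fails otherwise (e.g. V = ℂ with E_n = V for all n). *)

(* Defs.v *)
From HB Require Import structures.
From mathcomp Require Import all_boot all_order all_algebra.
From mathcomp Require Import boolp classical_sets cardinality fsbigop.
From mathcomp Require Export reals complex.

Set Implicit Arguments.
Unset Strict Implicit.
Unset Printing Implicit Defensive.

Import Order.TTheory GRing.Theory Num.Theory.
Local Open Scope classical_set_scope.
Local Open Scope quotient_scope.
Local Open Scope ring_scope.

Section Subspace.
Variables (K : pzRingType) (V : lmodType K) (S : submodClosed V).

Definition subspace : Type := {v : V | v \in S}.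
HB.instance Definition _ := SubChoice.on subspace.
HB.instance Definition _ :=
  GRing.SubChoice_isSubLmodule.Build K V _ subspace (GRing.subsemimodClosedP S).

End Subspace.

Section Quotient.
Variables (K : pzRingType) (V : lmodType K) (S : submodClosed V).

Definition lquot_pred : {pred V} := fun v => v \in S.

Fact lquot_pred_zmod : zmod_closed lquot_pred.
Proof.
have [S0 SL] := submodClosedP S; split => // u v Su Sv.
by rewrite addrC -scaleN1r; apply: SL.
Qed.
HB.instance Definition _ := GRing.isZmodClosed.Build V lquot_pred lquot_pred_zmod.

Definition lquot : Type := Quotient.quot lquot_pred.
HB.instance Definition _ := GRing.Zmodule.on lquot.

Definition lclass (v : V) : lquot := \pi_(Quotient.quot lquot_pred) v.
Definition lrepr (x : lquot) : V := repr (x : Quotient.quot lquot_pred).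

Lemma lreprK x : lclass (lrepr x) = x.
Proof. exact: reprK. Qed.

Lemma lclassP u v : lclass u = lclass v <-> u - v \in S.
Proof.
split => [/eqP|Suv]; last apply/eqP.
  by rewrite /lclass -Quotient.idealrBE.
by rewrite /lclass -Quotient.idealrBE.
Qed.

Lemma lclassD u v : lclass (u + v) = lclass u + lclass v.
Proof. by rewrite /lclass piE. Qed.

Definition lquot_scale (c : K) (x : lquot) : lquot := lclass (c *: lrepr x).

Lemma lquot_scaleE c v : lquot_scale c (lclass v) = lclass (c *: v).
Proof.
by apply/lclassP; rewrite -scalerBr rpredZ //; apply/lclassP/lreprK.
Qed.

Fact lquot_scaleA a b x : lquot_scale a (lquot_scale b x) = lquot_scale (a * b) x.
Proof. by rewrite -[x]lreprK !lquot_scaleE scalerA. Qed.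
Fact lquot_scale1 : left_id 1 lquot_scale.
Proof. by move=> x; rewrite -[x]lreprK !lquot_scaleE scale1r. Qed.
Fact lquot_scaleDr : right_distributive lquot_scale +%R.
Proof.
move=> a x y; rewrite -[x]lreprK -[y]lreprK -lclassD !lquot_scaleE.
by rewrite scalerDr lclassD.
Qed.
Fact lquot_scaleDl x : {morph lquot_scale^~ x : a b / a + b}.
Proof.
by move=> a b; rewrite -[x]lreprK /= !lquot_scaleE scalerDl lclassD.
Qed.
HB.instance Definition _ := GRing.Zmodule_isLmodule.Build K lquot
  lquot_scaleA lquot_scale1 lquot_scaleDr lquot_scaleDl.

Lemma lclassZ c v : lclass (c *: v) = c *: lclass v.
Proof. by rewrite -lquot_scaleE. Qed.

End Quotient.
Arguments lclass {K V} S v.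

Section DirectSum.
Variables (K : pzRingType) (I : choiceType) (A : I -> lmodType K).

Definition finite_supp (f : forall i, A i) : bool :=
  `[< finite_set [set i | f i != 0] >].

Definition dsum : Type := {f : forall i, A i | finite_supp f}.
HB.instance Definition _ := SubChoice.on dsum.

Definition DSum f (ff : finite_supp f) : dsum :=
  exist (fun f => is_true (finite_supp f)) f ff.
Definition dsum_fun (x : dsum) : forall i, A i := val x.
Coercion dsum_fun : dsum >-> Funclass.

Lemma dsumP (x y : dsum) : (forall i, x i = y i) -> x = y.
Proof. by move=> xy; apply: val_inj; apply: functional_extensionality_dep. Qed.

Lemma dsum_fin (x : dsum) : finite_set [set i | x i != 0].
Proof. exact/asboolP/(valP x). Qed.

Fact dsum0_fin : finite_supp (fun i => 0).
Proof.
apply/asboolP; rewrite (_ : [set _ | _] = set0) //.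
by apply/seteqP; split => i //=; rewrite eqxx.
Qed.
Fact dsumN_fin (x : dsum) : finite_supp (fun i => - x i).
Proof.
by apply/asboolP; apply: sub_finite_set (dsum_fin x) => i /=; rewrite oppr_eq0.
Qed.
Fact dsumD_fin (x y : dsum) : finite_supp (fun i => x i + y i).
Proof.
apply/asboolP.
apply: (@sub_finite_set _ _ ([set i | x i != 0] `|` [set i | y i != 0])).
  move=> i /= xy; case: (eqVneq (x i) 0) => [x0|]; last by left.
  by right; rewrite x0 add0r in xy.
by rewrite finite_setU; split; exact: dsum_fin.
Qed.
Fact dsumZ_fin c (x : dsum) : finite_supp (fun i => c *: x i).
Proof.
apply/asboolP; apply: sub_finite_set (dsum_fin x) => i /=.
by apply: contra => /eqP ->; rewrite scaler0.
Qed.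

Definition dsum0 : dsum := DSum dsum0_fin.
Definition dsumN (x : dsum) : dsum := DSum (dsumN_fin x).
Definition dsumD (x y : dsum) : dsum := DSum (dsumD_fin x y).
Definition dsumZ c (x : dsum) : dsum := DSum (dsumZ_fin c x).

Fact dsumA : associative dsumD.
Proof. by move=> x y z; apply: dsumP => i; exact: addrA. Qed.
Fact dsumC : commutative dsumD.
Proof. by move=> x y; apply: dsumP => i; exact: addrC. Qed.
Fact dsum0D : left_id dsum0 dsumD.
Proof. by move=> x; apply: dsumP => i; exact: add0r. Qed.
Fact dsumND : left_inverse dsum0 dsumN dsumD.
Proof. by move=> x; apply: dsumP => i; exact: addNr. Qed.
HB.instance Definition _ := GRing.isZmodule.Build dsum dsumA dsumC dsum0D dsumND.

Fact dsumZA a b x : dsumZ a (dsumZ b x) = dsumZ (a * b) x.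
Proof. by apply: dsumP => i; exact: scalerA. Qed.
Fact dsumZ1 : left_id 1 dsumZ.
Proof. by move=> x; apply: dsumP => i; exact: scale1r. Qed.
Fact dsumZDr : right_distributive dsumZ +%R.
Proof. by move=> a x y; apply: dsumP => i; exact: scalerDr. Qed.
Fact dsumZDl x : {morph dsumZ^~ x : a b / a + b}.
Proof. by move=> a b; apply: dsumP => i; exact: scalerDl. Qed.
HB.instance Definition _ := GRing.Zmodule_isLmodule.Build K dsum
  dsumZA dsumZ1 dsumZDr dsumZDl.

Fact dsum_in_fin i (a : A i) : finite_supp (dfwith (fun j => 0 : A j) a).
Proof.
apply/asboolP; apply: (@sub_finite_set _ _ [set i]); last exact: finite_set1.
move=> j /=; apply: contra_neqP => /eqP; rewrite eq_sym => ij.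
by rewrite dfwith_out.
Qed.
Definition dsum_in i (a : A i) : dsum := DSum (dsum_in_fin a).

End DirectSum.

Section PolyModule.
Variables (K : comNzRingType) (V : lmodType K).

(* The element [f] stands for the polynomial \sum_k f k h^k. *)
Definition vpoly : Type := dsum (fun _ : nat => V).
HB.instance Definition _ := GRing.Zmodule.on vpoly.
Definition vcoef (f : vpoly) (k : nat) : V := dsum_fun f k.

Definition vconst (v : V) : vpoly := dsum_in (A := fun _ : nat => V) (i := 0%N) v.

Fact vpoly_scale_fin (p : {poly K}) (f : vpoly) :
  finite_supp (A := fun _ : nat => V)
    (fun k => \sum_(i < k.+1) p`_i *: vcoef f (k - i)).
Proof.
apply/asboolP.
apply: (@sub_finite_set _ _
  ((fun ij => (ij.1 + ij.2)%N) @`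
    (`I_(size p) `*` [set j | vcoef f j != 0]))); last first.
  by apply: finite_image; apply: finite_setX;
    [exact: finite_II|exact: dsum_fin].
move=> k /=; apply: contra_neqP => nk; apply: big1 => i _.
case: (ltnP i (size p)) => [ip|pi]; last by rewrite nth_default ?scale0r.
case: (eqVneq (vcoef f (k - i)) 0) => [->|fk]; first by rewrite scaler0.
by case: nk; exists (i : nat, (k - i)%N) => //=; rewrite subnKC // -ltnS.
Qed.
Definition vpoly_scale (p : {poly K}) (f : vpoly) : vpoly :=
  DSum (vpoly_scale_fin p f).

Lemma vcoef_scale p f k :
  vcoef (vpoly_scale p f) k = \sum_(i < k.+1) p`_i *: vcoef f (k - i).
Proof. by []. Qed.

Lemma vcoefD f g k : vcoef (f + g) k = vcoef f k + vcoef g k.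
Proof. by []. Qed.

Lemma vcoef_scale_rev p f k :
  vcoef (vpoly_scale p f) k = \sum_(i < k.+1) p`_(k - i) *: vcoef f i.
Proof.
rewrite vcoef_scale (reindex_inj rev_ord_inj) /=; apply: eq_bigr => i _.
by rewrite subKn // -ltnS.
Qed.

Lemma vpolyP (f g : vpoly) : (forall k, vcoef f k = vcoef g k) -> f = g.
Proof. exact: dsumP. Qed.

Fact vpoly_scaleA p q f :
  vpoly_scale p (vpoly_scale q f) = vpoly_scale (p * q) f.
Proof.
apply: vpolyP => k; rewrite vcoef_scale vcoef_scale_rev.
pose c j i := (p`_j * q`_(k - j - i)) *: vcoef f i.
transitivity (\sum_(j < k.+1) \sum_(i < k.+1 | (i <= k - j)%N) c j i).
  apply: eq_bigr => /= j _; rewrite vcoef_scale_rev scaler_sumr.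
  rewrite (big_ord_narrow_leq (leq_subr _ _)).
  by apply: eq_bigr => i _; rewrite scalerA.
rewrite (exchange_big_dep predT) //=; apply: eq_bigr => i _.
transitivity (\sum_(j < k.+1 | (j <= k - i)%N) c j i).
  apply: eq_bigl => j; rewrite -ltnS -(ltnS j) -!subSn ?leq_ord //.
  by rewrite -subn_gt0 -(subn_gt0 j) -!subnDA addnC.
rewrite (big_ord_narrow_leq (leq_subr _ _)) coefM scaler_suml /=.
by apply: eq_bigr => j _; rewrite /c -!subnDA addnC.
Qed.
Fact vpoly_scale1 : left_id 1 vpoly_scale.
Proof.
move=> f; apply: vpolyP => k; rewrite vcoef_scale big_ord_recl /= coef1 subn0.
rewrite scale1r big1 ?addr0 // => i _.
by rewrite coef1 scale0r.
Qed.
Fact vpoly_scaleDr : right_distributive vpoly_scale +%R.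
Proof.
move=> p f g; apply: vpolyP => k; rewrite vcoefD !vcoef_scale -big_split.
by apply: eq_bigr => i _; rewrite vcoefD scalerDr.
Qed.
Fact vpoly_scaleDl f : {morph vpoly_scale^~ f : p q / p + q}.
Proof.
move=> p q; apply: vpolyP => k; rewrite vcoefD !vcoef_scale -big_split.
by apply: eq_bigr => i _; rewrite coefD scalerDl.
Qed.
HB.instance Definition _ := GRing.Zmodule_isLmodule.Build {poly K} vpoly
  vpoly_scaleA vpoly_scale1 vpoly_scaleDr vpoly_scaleDl.

End PolyModule.

Section Specialization.
Variables (K : comNzRingType) (W : lmodType {poly K}).

(* W as a K-module, along K -> K[h]. *)
Definition restrict : Type := W.
HB.instance Definition _ := GRing.Zmodule.on restrict.

Definition restrict_scale (c : K) (w : restrict) : restrict :=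
  c%:P *: (w : W).

Fact restrict_scaleA a b w :
  restrict_scale a (restrict_scale b w) = restrict_scale (a * b) w.
Proof. by rewrite /restrict_scale scalerA polyCM. Qed.
Fact restrict_scale1 : left_id 1 restrict_scale.
Proof. by move=> w; rewrite /restrict_scale scale1r. Qed.
Fact restrict_scaleDr : right_distributive restrict_scale +%R.
Proof. by move=> a u v; apply: scalerDr. Qed.
Fact restrict_scaleDl w : {morph restrict_scale^~ w : a b / a + b}.
Proof. by move=> a b; rewrite /restrict_scale polyCD; apply: scalerDl. Qed.
HB.instance Definition _ := GRing.Zmodule_isLmodule.Build K restrict
  restrict_scaleA restrict_scale1 restrict_scaleDr restrict_scaleDl.

Variable f : {poly K}.

Definition multiples : {pred restrict} :=
  fun w => `[< exists w' : W, w = f *: w' >].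

Fact multiples_submod : subsemimod_closed multiples.
Proof.
split; first split.
- by apply/asboolP; exists 0; rewrite scaler0.
- move=> u v /asboolP[u' ->] /asboolP[v' ->]; apply/asboolP.
  by exists (u' + v'); rewrite scalerDr.
move=> c v /asboolP[v' ->]; apply/asboolP; exists (c%:P *: v').
by rewrite scalerA [f * _]mulrC -scalerA.
Qed.
HB.instance Definition _ :=
  GRing.isSubmodClosed.Build K restrict multiples multiples_submod.

(* W/fW, over K. *)
Definition specialize : lmodType K := lquot multiples.
Definition spec_class (w : W) : specialize := lclass multiples w.
Definition spec_repr (x : specialize) : W := lrepr x.

(* Independent of the representatives for bilinear Y: see [spec_modeE]. *)
Definition spec_mode (Y : W -> int -> W -> W)
    (x : specialize) (n : int) (y : specialize) : specialize :=
  spec_class (Y (spec_repr x) n (spec_repr y)).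

Lemma spec_classP (u v : W) :
  spec_class u = spec_class v <-> exists w : W, u - v = f *: w.
Proof.
split; first by move/lclassP/asboolP.
by move=> uv; apply/lclassP/asboolP.
Qed.

Lemma spec_modeE (Y : W -> int -> W -> W) :
    (forall n v, linear (fun u => Y u n v)) -> (forall u n, linear (Y u n)) ->
  forall u n v,
    spec_mode Y (spec_class u) n (spec_class v) = spec_class (Y u n v).
Proof.
move=> Yl Yr u n v.
have [a ua] : exists a : W, spec_repr (spec_class u) - u = f *: a.
  by apply/spec_classP/lreprK.
have [b vb] : exists b : W, spec_repr (spec_class v) - v = f *: b.
  by apply/spec_classP/lreprK.
apply/spec_classP.
move/eqP: ua; rewrite subr_eq => /eqP ->.
move/eqP: vb; rewrite subr_eq => /eqP ->.
rewrite Yl (Yr u n); exists (Y a n (f *: b + v) + Y u n b).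
by rewrite scalerDr addrA addrK.
Qed.

End Specialization.

(* The generalized binomial coefficient l(l-1)...(l-i+1)/i! for l in Z. *)
Definition binz (l : int) (i : nat) : int :=
  match l with
  | Posz n => 'C(n, i)%:Z
  | Negz n => (-1) ^+ i * 'C(n + i, i)%:Z
  end.

Lemma binz_ffact l i :
  binz l i * (i`!)%:Z = \prod_(j < i) (l - (j : nat)%:Z).
Proof.
case: l => n /=.
  rewrite -PoszM bin_ffact ffact_prod.
  have [ni|in_] := ltnP n i.
    rewrite (bigD1 (Ordinal ni)) //= subnn mul0n.
    by rewrite (bigD1 (Ordinal ni)) //= subrr mul0r.
  rewrite (big_morph Posz PoszM (erefl (Posz 1))); apply: eq_bigr => j _.
  by rewrite subzn // ltnW // (leq_trans (ltn_ord j)).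
rewrite -mulrA -PoszM bin_ffact ffact_prod.
rewrite (big_morph Posz PoszM (erefl (Posz 1))) [in LHS](reindex_inj rev_ord_inj).
rewrite -[i in (-1) ^+ i]card_ord -prodr_const -big_split /=.
apply: eq_bigr => j _; rewrite NegzE.
have -> : (n + i - (i - j.+1) = n.+1 + j)%N.
  by rewrite subnBA // addnAC addnK addnS addSn.
by rewrite PoszD mulN1r opprD.
Qed.

Section VertexAlgebra.
Variables (K : comNzRingType) (V : lmodType K).
(* [Y u n v] is u_n v, i.e. Y(u,x)v = \sum_n (Y u n v) x^(-n-1). *)
Variables (Y : V -> int -> V -> V) (vac : V).

(* The last field equates the coefficients of
   x_0^(-l-1) x_1^(-m-1) x_2^(-n-1) in the two sides of the Jacobi identity
   applied to w; all three sums have finite support by [va_trunc]. *)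
Record vertex_algebra : Prop := VertexAlgebra {
  va_linearl : forall n v, linear (fun u => Y u n v);
  va_linearr : forall u n, linear (Y u n);
  va_trunc : forall u v, exists N : int, forall n, N <= n -> Y u n v = 0;
  va_vacuum : forall n v, Y vac n v = if n == -1 then v else 0;
  va_creation : forall v,
    Y v (-1) vac = v /\ forall n : int, 0 <= n -> Y v n vac = 0;
  va_jacobi : forall (l m n : int) (u v w : V),
    \sum_(i \in [set: nat])
       Y u (m + l - i%:Z) (Y v (n + i%:Z) w) *~ ((-1) ^+ i * binz l i)
    - \sum_(i \in [set: nat])
       Y v (n + l - i%:Z) (Y u (m + i%:Z) w) *~ ((-1) ^+ (`|l| + i) * binz l i)
    = \sum_(i \in [set: nat])
       Y (Y u (l + i%:Z) v) (m + n - i%:Z) w *~ binz m i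
}.

(* [Y(u,x_1), Y(v,x_2)] = 0 for all u, v. *)
Definition va_commutative : Prop :=
  forall u v m n w, Y u m (Y v n w) = Y v n (Y u m w).

Record good_filtration (E : int -> submodClosed V) : Prop := GoodFiltration {
  gf_incr : forall m n : int, m <= n -> {subset E m <= E n};
  gf_exhaustive : forall v, exists n, v \in E n;
  gf_vac : vac \in E 0;
  gf_neg : forall m n u v, u \in E m -> v \in E n ->
    forall j : int, j < 0 -> Y u j v \in E (m + n);
  gf_nneg : forall m n u v, u \in E m -> v \in E n ->
    forall j : int, 0 <= j -> Y u j v \in E (m + n - 1)
}.

End VertexAlgebra.

Definition va_isomorphism (K : comNzRingType) (V V' : lmodType K)
    (Y : V -> int -> V -> V) (vac : V) (Y' : V' -> int -> V' -> V') (vac' : V')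
    (f : V -> V') : Prop :=
  [/\ linear f, bijective f, f vac = vac' &
      forall u n v, f (Y u n v) = Y' (f u) n (f v)].

Section VertexPoisson.
Variables (K : fieldType).

Section VertexLie.
Variables (A : lmodType K) (der : A -> A) (prod : nat -> A -> A -> A).

(* [prod n a b] is a_n b. *)
Record vertex_lie_algebra : Prop := VertexLieAlgebra {
  vl_der_linear : linear der;
  vl_linearl : forall n b, linear (fun a => prod n a b);
  vl_linearr : forall n a, linear (prod n a);
  vl_C0 : forall a b, exists N, forall n, (N <= n)%N -> prod n a b = 0;
  vl_C1 : forall n a b, prod n (der a) b = - (n%:R *: prod n.-1 a b);
  vl_C2 : forall n a b, prod n a b =
    \sum_(i \in [set: nat])
      (-1) ^+ (n + i + 1) *: ((i`!)%:R^-1 *: iter i der (prod (n + i)%N b a));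
  vl_C3 : forall m n a b c,
    prod m a (prod n b c) - prod n b (prod m a c) =
    \sum_(i < m.+1) 'C(m, i)%:R *: prod (m + n - i)%N (prod i a b) c
}.
End VertexLie.

Record vpa_data (A : lmodType K) := VPAData {
  vp_mul : A -> A -> A;
  vp_one : A;
  vp_der : A -> A;
  vp_prod : nat -> A -> A -> A
}.

Definition derivation (A : lmodType K) (mul : A -> A -> A) (d : A -> A) : Prop :=
  linear d /\ forall a b, d (mul a b) = mul (d a) b + mul a (d b).

Record vertex_poisson_algebra (A : lmodType K) (S : vpa_data A) : Prop :=
  VertexPoissonAlgebra {
  vp_linearl : forall b, linear (fun a => vp_mul S a b);
  vp_linearr : forall a, linear (vp_mul S a);
  vp_mulA : associative (vp_mul S);
  vp_mulC : commutative (vp_mul S);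
  vp_mul1 : left_id (vp_one S) (vp_mul S);
  vp_der_derivation : derivation (vp_mul S) (vp_der S);
  vp_lie : vertex_lie_algebra (vp_der S) (vp_prod S);
  vp_prod_derivation : forall n a, derivation (vp_mul S) (vp_prod S n a)
}.

Definition vpa_isomorphism (A B : lmodType K) (S : vpa_data A) (T : vpa_data B)
    (f : A -> B) : Prop :=
  [/\ linear f /\ bijective f,
      f (vp_one S) = vp_one T,
      forall a b, f (vp_mul S a b) = vp_mul T (f a) (f b),
      forall a, f (vp_der S a) = vp_der T (f a) &
      forall n a b, f (vp_prod S n a b) = vp_prod T n (f a) (f b)].

End VertexPoisson.

Section Graded.
Variables (K : fieldType) (V : lmodType K) (E : int -> submodClosed V).

Definition gr_sub (n : int) : {pred (subspace (E n))} :=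
  fun x => val x \in E (n - 1).

Lemma in_gr_sub n (x : subspace (E n)) :
  (x \in @gr_sub n) = (val x \in E (n - 1)).
Proof. by []. Qed.

Fact gr_sub_submod n : subsemimod_closed (@gr_sub n).
Proof.
split; first split.
- by rewrite in_gr_sub raddf0 rpred0.
- by move=> x y; rewrite !in_gr_sub raddfD; exact: rpredD.
by move=> c x; rewrite !in_gr_sub linearZ; exact: rpredZ.
Qed.
HB.instance Definition _ n :=
  GRing.isSubmodClosed.Build K (subspace (E n)) (@gr_sub n) (gr_sub_submod n).

Definition gr_piece (n : int) : lmodType K := lquot (@gr_sub n).

Definition gr : lmodType K := dsum gr_piece.

(* The class v + E_(n-1), for v in E_n (a junk value, 0, otherwise). *)
Definition gr_class (n : int) (v : V) : gr :=
  dsum_in (A := gr_piece) (lclass (@gr_sub n) (insubd (0 : subspace (E n)) v)).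

Variables (Y : V -> int -> V -> V) (vac : V).

(* gr is spanned by the classes, so this determines all of S. *)
Record gr_structure (S : vpa_data gr) : Prop := GrStructure {
  grs_vpa : vertex_poisson_algebra S;
  grs_one : vp_one S = gr_class 0 vac;
  grs_mul : forall m n u v, u \in E m -> v \in E n ->
    vp_mul S (gr_class m u) (gr_class n v) = gr_class (m + n) (Y u (-1) v);
  grs_der : forall m u, u \in E m ->
    vp_der S (gr_class m u) = gr_class m (Y u (-2) vac);
  grs_prod : forall m n u v, u \in E m -> v \in E n -> forall i : nat,
    vp_prod S i (gr_class m u) (gr_class n v)
    = gr_class (m + n - 1) (Y u i%:Z v)
}.

End Graded.

(* The structure on W/hW; w plays the role of (1/h) u_i v. *)
Record quotient_structure (K : fieldType) (W : lmodType {poly K})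
    (Y : W -> int -> W -> W) (vac : W)
    (T : vpa_data (specialize W 'X)) : Prop := QuotientStructure {
  qs_vpa : vertex_poisson_algebra T;
  qs_one : vp_one T = spec_class 'X vac;
  qs_mul : forall u v, vp_mul T (spec_class 'X u) (spec_class 'X v)
    = spec_class 'X (Y u (-1) v);
  qs_der : forall u, vp_der T (spec_class 'X u) = spec_class 'X (Y u (-2) vac);
  qs_prod : forall (i : nat) u v w, 'X *: w = Y u i%:Z v ->
    vp_prod T i (spec_class 'X u) (spec_class 'X v) = spec_class 'X w
}.

Section Decomposition.
Variables (K : fieldType) (V : lmodType K).

(* E = U (+) E' *)
Definition direct_complement (E E' U : submodClosed V) : Prop :=
  (forall v, v \in E <-> exists2 u, u \in U & exists2 w, w \in E' & v = u + w)
  /\ (forall v, v \in U -> v \in E' -> v = 0).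

Definition internal_direct_sum (U : nat -> submodClosed V) : Prop :=
  forall v, exists! s : nat -> V,
    [/\ forall n, s n \in U n, finite_set [set n | s n != 0] &
        v = \sum_(n \in [set: nat]) s n].

Definition projections (U : nat -> submodClosed V)
    (p : nat -> {linear V -> V}) : Prop :=
  forall n m u, u \in U m -> p n u = if n == m then u else 0.

(* Y_h is K[h]-bilinear, and is determined by its values on the U_m,
   which span V[h] over K[h]. *)
Definition deformed_modes (U : nat -> submodClosed V) (p : nat -> {linear V -> V})
    (Y : V -> int -> V -> V) (Yh : vpoly V -> int -> vpoly V -> vpoly V) : Prop :=
  [/\ forall r g, linear (fun f => Yh f r g),
      forall f r, linear (Yh f r) &
      forall m n u v, u \in U m -> v \in U n -> forall r,
        Yh (vconst u) r (vconst v) =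
        \sum_(j < (m + n).+1) 'X^(m + n - j) *: vconst (p j (Y u r v))].

End Decomposition.

(* Main.v *)
(* The map sending h^k u to h^(k+m) u, for u in U_m, is an injective K[h]-linear
   map Theta : V[h] -> V[h] whose image is the Rees module \sum_n E_n h^n.  The
   filtration being good, the Rees module is stable under the K[h]-bilinear
   extension of Y to V[h], and Y_h is this extension pulled back along Theta; so
   the Jacobi identity for Y_h comes from the one for Y.  As u_i v lies in
   E_(m+n-1) for i >= 0, it becomes divisible by h in V[h], and dividing by h
   the identities that hold in V[h] gives the vertex Poisson structure of
   V[h]/hV[h]; that of gr V is its transport along phi. *)
Require Import Defs.
From HB Require Import structures.
From mathcomp Require Import all_boot all_order all_algebra.
From mathcomp Require Import boolp classical_sets cardinality fsbigop.
From mathcomp Require Import reals complex.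
From mathcomp Require Import zify.

Set Implicit Arguments.
Unset Strict Implicit.
Unset Printing Implicit Defensive.

Import Order.TTheory GRing.Theory Num.Theory.
Local Open Scope ring_scope.

(** Two obstacles shape the proof. The sums in the Jacobi identity have supports that depend on the
    arguments, so the identity is replaced by a finite one, cut at a common N and required for all
    large N. In that form it is multilinear, can be checked on generators of V[h], and moves along
    injective and surjective homomorphisms. The other obstacle is that [h^k v] with v in [E_m] has
    no simple description in V[h]. The element of V[h] that Theta sends to [h^m v] is therefore used
    instead. On such lifts Y_h multiplies exactly, the power of h recording the degree. Modulo h
    only the component in [U_m] survives, which gives phi; modulo h - 1 all components are added up
    again, which gives psi. Vanishing of [E_(-1)] starts the decomposition of V, and it makes the
    constant coefficient of a nonnegative mode vanish, so that division by h stays inside the Rees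
    module. The vertex Poisson axioms are proved once, on V[h]/hV[h], where division by h is
    unambiguous because h is injective. *)

Section LinearFunctions.
Variables (K : pzRingType) (V W : lmodType K) (f : V -> W).
Hypothesis lf : linear f.

Definition linear_pack : {linear V -> W} :=
  HB.pack f (GRing.isLinear.Build K V W *:%R f lf).

Lemma linearf0 : f 0 = 0. Proof. exact: (raddf0 linear_pack). Qed.
Lemma linearfD u v : f (u + v) = f u + f v.
Proof. exact: (raddfD linear_pack). Qed.
Lemma linearfN u : f (- u) = - f u. Proof. exact: (raddfN linear_pack). Qed.
Lemma linearfB u v : f (u - v) = f u - f v.
Proof. exact: (raddfB linear_pack). Qed.
Lemma linearfZ c u : f (c *: u) = c *: f u.
Proof. exact: (linearZ_LR linear_pack). Qed.
Lemma linearf_sum I (r : seq I) (P : pred I) F :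
  f (\sum_(i <- r | P i) F i) = \sum_(i <- r | P i) f (F i).
Proof. exact: (raddf_sum linear_pack). Qed.

End LinearFunctions.

Lemma linearP_gen (K : pzRingType) (V W : lmodType K) (f : V -> W) :
  (forall u v, f (u + v) = f u + f v) -> (forall c u, f (c *: u) = c *: f u) ->
  linear f.
Proof. by move=> fD fZ c u v; rewrite fD fZ. Qed.

Lemma fsum_bounded (M : nmodType) (F : nat -> M) (N : nat) :
  (forall i, (N <= i)%N -> F i = 0) ->
  \sum_(i \in [set: nat]) F i = \sum_(i < N) F i.
Proof.
move=> F0; rewrite fsbig_ord; apply/esym/fsbig_widen => //.
by move=> i [_ /= /negP]; rewrite -leqNgt => /F0.
Qed.

Lemma sum_ord_widen (M : nmodType) (F : nat -> M) (m n : nat) :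
  (m <= n)%N -> (forall i, (m <= i)%N -> F i = 0) ->
  \sum_(i < n) F i = \sum_(i < m) F i.
Proof.
move=> mn F0; rewrite -!(fsum_bounded (F := F)) // => i ni.
by apply: F0; apply: leq_trans ni.
Qed.

Lemma sum_ord_single (M : nmodType) (F : nat -> M) (n j : nat) :
  (j < n)%N -> (forall i, i != j -> F i = 0) -> \sum_(i < n) F i = F j.
Proof.
move=> jn F0; rewrite (bigD1 (Ordinal jn)) //= big1 ?addr0 // => i ij.
by apply: F0; apply: contra_neq ij => ij; apply: val_inj.
Qed.

Lemma binz0l i : binz 0 i = (i == 0%N)%:R.
Proof. by case: i. Qed.

Lemma binz0r l : binz l 0 = 1.
Proof. by case: l => n /=; rewrite ?bin0 // expr0 mul1r bin0. Qed.

Lemma binzN1 i : binz (-1) i = (-1) ^+ i.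
Proof. by rewrite /= add0n binn mulr1. Qed.

Lemma binzN2 i : binz (-2) i = (-1) ^+ i * i.+1%:R.
Proof. by rewrite /= add1n binSn natz. Qed.

(** * The Jacobi identity in terms of finite sums *)

Section BoundedJacobi.
Variables (K : comNzRingType) (V : lmodType K) (Y : V -> int -> V -> V).

(* The difference of the two sides of the Jacobi identity, each of its three
   sums being cut at N; truncation makes it independent of N for N large. *)
Definition jacobi_sum (l m n : int) (u v w : V) (N : nat) : V :=
  \sum_(i < N)
   (Y u (m + l - i%:Z) (Y v (n + i%:Z) w) *~ ((-1) ^+ i * binz l i)
    - Y v (n + l - i%:Z) (Y u (m + i%:Z) w) *~ ((-1) ^+ (`|l| + i) * binz l i)
    - Y (Y u (l + i%:Z) v) (m + n - i%:Z) w *~ binz m i).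

(** The threshold depends on u, v, w, but thresholds can be added. Hence the condition is stable
    under linear combinations in each argument. *)
Definition eventually_jacobi l m n u v w : Prop :=
  exists N0, forall N, (N0 <= N)%N -> jacobi_sum l m n u v w N = 0.

Hypothesis Yl : forall n v, linear (fun u => Y u n v).
Hypothesis Yr : forall u n, linear (Y u n).
Hypothesis Yt : forall u v, exists N : int, forall n, N <= n -> Y u n v = 0.

Lemma mode_trunc u v (l : int) :
  exists N : nat, forall i : nat, (N <= i)%N -> Y u (l + i%:Z) v = 0.
Proof.
have [N YN] := Yt u v; exists `|N - l|%N => i Ni; apply: YN; lia.
Qed.

(** Truncation for the pairs (v, w), (u, w) and (u, v) bounds the supports of the three families, so
    past the sum of the three bounds cutting loses nothing. *)
Lemma jacobi_eventually l m n u v w :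
  (\sum_(i \in [set: nat])
     Y u (m + l - i%:Z) (Y v (n + i%:Z) w) *~ ((-1) ^+ i * binz l i)
  - \sum_(i \in [set: nat])
     Y v (n + l - i%:Z) (Y u (m + i%:Z) w) *~ ((-1) ^+ (`|l| + i) * binz l i)
  = \sum_(i \in [set: nat])
     Y (Y u (l + i%:Z) v) (m + n - i%:Z) w *~ binz m i)
  <-> eventually_jacobi l m n u v w.
Proof.
have [N1 Y1] := mode_trunc v w n; have [N2 Y2] := mode_trunc u w m.
have [N3 Y3] := mode_trunc u v l.
have E N : (N1 + N2 + N3 <= N)%N -> jacobi_sum l m n u v w N =
    \sum_(i \in [set: nat])
       Y u (m + l - i%:Z) (Y v (n + i%:Z) w) *~ ((-1) ^+ i * binz l i)
    - \sum_(i \in [set: nat])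
       Y v (n + l - i%:Z) (Y u (m + i%:Z) w) *~ ((-1) ^+ (`|l| + i) * binz l i)
    - \sum_(i \in [set: nat])
       Y (Y u (l + i%:Z) v) (m + n - i%:Z) w *~ binz m i.
  move=> NN; rewrite /jacobi_sum !sumrB !(fsum_bounded (N := N)) // => i Ni.
  - by rewrite Y3 ?(linearf0 (Yl _ _)) ?mul0rz //; lia.
  - by rewrite Y2 ?(linearf0 (Yr _ _)) ?mul0rz //; lia.
  - by rewrite Y1 ?(linearf0 (Yr _ _)) ?mul0rz //; lia.
split=> [J | [N0 J]].
  by exists (N1 + N2 + N3)%N => N /E ->; rewrite J subrr.
apply/eqP; rewrite -subr_eq0; apply/eqP.
by rewrite -(E (N0 + (N1 + N2 + N3))%N) ?leq_addl // J // leq_addr.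
Qed.

Lemma jacobi_sum_linear1 l m n v w N :
  linear (fun u => jacobi_sum l m n u v w N).
Proof.
move=> c a b; rewrite /jacobi_sum scaler_sumr -big_split.
apply: eq_bigr => i _ /=.
rewrite !Yl Yr !mulrzDl !scalerMzr !scalerBr.
by rewrite !opprD [X in X + _ = _]addrACA [LHS]addrACA.
Qed.

Lemma jacobi_sum_linear2 l m n u w N :
  linear (fun v => jacobi_sum l m n u v w N).
Proof.
move=> c a b; rewrite /jacobi_sum scaler_sumr -big_split.
apply: eq_bigr => i _ /=.
rewrite !(Yl, Yr) !mulrzDl !scalerMzr !scalerBr.
by rewrite !opprD [X in X + _ = _]addrACA [LHS]addrACA.
Qed.

Lemma jacobi_sum_linear3 l m n u v N :
  linear (fun w => jacobi_sum l m n u v w N).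
Proof.
move=> c a b; rewrite /jacobi_sum scaler_sumr -big_split.
apply: eq_bigr => i _ /=.
rewrite !Yr !mulrzDl !scalerMzr !scalerBr.
by rewrite !opprD [X in X + _ = _]addrACA [LHS]addrACA.
Qed.

Lemma vertex_algebra_eventually vac :
  (forall n v, Y vac n v = if n == -1 then v else 0) ->
  (forall v, Y v (-1) vac = v /\ forall n : int, 0 <= n -> Y v n vac = 0) ->
  (forall l m n u v w, eventually_jacobi l m n u v w) ->
  vertex_algebra Y vac.
Proof. by move=> V1 V2 J; split => // *; apply/jacobi_eventually. Qed.

End BoundedJacobi.

(** All coefficients are integers, so additivity of f is enough and the base rings may differ. They
    do for [vconst], from K to K[h], and for [spec_class], from K[h] to K. *)
Lemma jacobi_sum_hom (K K' : comNzRingType) (V : lmodType K) (W : lmodType K')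
    (Y : V -> int -> V -> V) (Y' : W -> int -> W -> W) (f : {additive V -> W}) :
  (forall u n v, f (Y u n v) = Y' (f u) n (f v)) ->
  forall l m n u v w N, f (jacobi_sum Y l m n u v w N) =
    jacobi_sum Y' l m n (f u) (f v) (f w) N.
Proof.
move=> fY l m n u v w N; rewrite /jacobi_sum raddf_sum; apply: eq_bigr => i _.
by rewrite !raddfB !raddfMz !fY.
Qed.

(** * Vertex algebra structures along injective and surjective homomorphisms *)

Section VertexAlgebraTransfer.
Variables (K K' : comNzRingType) (V : lmodType K) (W : lmodType K').
Variables (Y : V -> int -> V -> V) (vac : V) (Y' : W -> int -> W -> W).
Variable f : {additive V -> W}.
Hypothesis fY : forall u n v, f (Y u n v) = Y' (f u) n (f v).

(** Every axiom except linearity is an equality of values, which can be tested after applying f.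
    Linearity of Y is assumed because f is merely additive. *)
Lemma vertex_algebra_inj :
  injective f -> (forall n v, linear (fun u => Y u n v)) ->
  (forall u n, linear (Y u n)) ->
  vertex_algebra Y' (f vac) -> vertex_algebra Y vac.
Proof.
move=> finj Yl Yr Y'V.
have Yt u v : exists N : int, forall n, N <= n -> Y u n v = 0.
  have [N YN] := va_trunc Y'V (f u) (f v); exists N => n Nn.
  by apply: finj; rewrite fY YN ?raddf0.
apply: vertex_algebra_eventually => //.
- move=> n v; apply: finj; rewrite fY (va_vacuum Y'V).
  by case: ifP => // _; rewrite raddf0.
- move=> v; have [Yv1 Yv0] := va_creation Y'V (f v).
  by split=> [|n n0]; apply: finj; rewrite fY // Yv0 ?raddf0.
move=> l m n u v w; have /(jacobi_eventually _ _ _) [] :=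
  va_jacobi Y'V l m n (f u) (f v) (f w).
- exact: va_linearl Y'V.
- exact: va_linearr Y'V.
- exact: va_trunc Y'V.
move=> N0 J; exists N0 => N /J; rewrite -(jacobi_sum_hom fY) => J0.
by apply: finj; rewrite J0 raddf0.
Qed.

Lemma vertex_algebra_surj :
  (forall x, exists u, f u = x) -> (forall n v, linear (fun u => Y' u n v)) ->
  (forall u n, linear (Y' u n)) ->
  vertex_algebra Y vac -> vertex_algebra Y' (f vac).
Proof.
move=> fsurj Yl Yr YV.
have Yt u v : exists N : int, forall n, N <= n -> Y' u n v = 0.
  have [[u' <-] [v' <-]] := (fsurj u, fsurj v).
  have [N YN] := va_trunc YV u' v'; exists N => n Nn.
  by rewrite -fY YN ?raddf0.
apply: vertex_algebra_eventually => //.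
- move=> n v; have [v' <-] := fsurj v; rewrite -fY (va_vacuum YV).
  by case: ifP => // _; rewrite raddf0.
- move=> v; have [v' <-] := fsurj v; have [Yv1 Yv0] := va_creation YV v'.
  by split=> [|n n0]; rewrite -fY ?Yv1 // Yv0 ?raddf0.
move=> l m n u v w.
have [[u' <-] [v' <-] [w' <-]] := And3 (fsurj u) (fsurj v) (fsurj w).
have /(jacobi_eventually _ _ _) [] := va_jacobi YV l m n u' v' w'.
- exact: va_linearl YV.
- exact: va_linearr YV.
- exact: va_trunc YV.
by move=> N0 J; exists N0 => N /J; rewrite -(jacobi_sum_hom fY) => ->;
  rewrite raddf0.
Qed.

End VertexAlgebraTransfer.

(** * The vertex algebra W/fW *)

Section SpecializeVertexAlgebra.
Variables (K : comNzRingType) (W : lmodType {poly K}) (f : {poly K}).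
Variables (Y : W -> int -> W -> W) (vac : W).

Lemma spec_classD (u v : W) :
  spec_class f (u + v) = spec_class f u + spec_class f v.
Proof. exact: lclassD. Qed.

Lemma spec_classZ c (u : W) : spec_class f (c%:P *: u) = c *: spec_class f u.
Proof. exact: (lclassZ (multiples f) c u). Qed.

Fact spec_class_additive : zmod_morphism (spec_class f : W -> _).
Proof.
move=> u v; rewrite spec_classD; congr (_ + _).
by rewrite -scaleN1r -polyC1 -polyCN spec_classZ scaleN1r.
Qed.
HB.instance Definition _ :=
  GRing.isZmodMorphism.Build W (specialize W f) (spec_class f)
    spec_class_additive.

Lemma spec_classMl (u : W) : spec_class f (f *: u) = 0.
Proof. by rewrite -[RHS](raddf0 (spec_class f)); apply/spec_classP; exists u;
  rewrite subr0. Qed.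

Lemma spec_class_surj x : exists u : W, spec_class f u = x.
Proof. by exists (spec_repr x); apply: lreprK. Qed.

Hypothesis YV : vertex_algebra Y vac.

Lemma spec_mode_class u n v :
  spec_mode (f := f) Y (spec_class f u) n (spec_class f v) =
  spec_class f (Y u n v).
Proof. exact: spec_modeE (va_linearl YV) (va_linearr YV) u n v. Qed.

Lemma vertex_algebra_specialize :
  vertex_algebra (spec_mode (f := f) Y) (spec_class f vac).
Proof.
apply: (vertex_algebra_surj (Y := Y)) => //.
- by move=> u n v; rewrite spec_mode_class.
- exact: spec_class_surj.
- move=> n z c x y; have [[z' <-] [x' <-] [y' <-]] :=
    And3 (spec_class_surj z) (spec_class_surj x) (spec_class_surj y).
  rewrite -spec_classZ -spec_classD !spec_mode_class (va_linearl YV).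
  by rewrite spec_classD spec_classZ.
- move=> z n c x y; have [[z' <-] [x' <-] [y' <-]] :=
    And3 (spec_class_surj z) (spec_class_surj x) (spec_class_surj y).
  rewrite -spec_classZ -spec_classD !spec_mode_class (va_linearr YV).
  by rewrite spec_classD spec_classZ.
Qed.

End SpecializeVertexAlgebra.

(** * Consequences of the Jacobi identity: commutators, derivation, skew symmetry *)

Section VertexAlgebraIdentities.
Variables (K : comNzRingType) (V : lmodType K).
Variables (Y : V -> int -> V -> V) (vac : V).
Hypothesis YV : vertex_algebra Y vac.

Let Yl := va_linearl YV.
Let Yr := va_linearr YV.
Let Y0l n v : Y 0 n v = 0. Proof. exact: (linearf0 (Yl n v)). Qed.
Let Y0r u n : Y u n 0 = 0. Proof. exact: (linearf0 (Yr u n)). Qed.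

Definition va_der (v : V) : V := Y v (-2) vac.

Lemma va_der_linear : linear va_der.
Proof. exact: Yl. Qed.

Lemma mode_vac n v : n != -1 -> Y vac n v = 0.
Proof. by rewrite (va_vacuum YV) => /negPf ->. Qed.

Lemma mode_vacN1 v : Y vac (-1) v = v.
Proof. by rewrite (va_vacuum YV) eqxx. Qed.

Lemma modeN1_vac v : Y v (-1) vac = v.
Proof. by have [] := va_creation YV v. Qed.

Lemma mode_nneg_vac v n : 0 <= n -> Y v n vac = 0.
Proof. by have [_] := va_creation YV v; apply. Qed.

Lemma jacobi_eq l m n u v w :
  exists N0, forall N, (N0 <= N)%N ->
  \sum_(i < N) Y u (m + l - i%:Z) (Y v (n + i%:Z) w) *~ ((-1) ^+ i * binz l i)
  - \sum_(i < N)
      Y v (n + l - i%:Z) (Y u (m + i%:Z) w) *~ ((-1) ^+ (`|l| + i) * binz l i)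
  = \sum_(i < N) Y (Y u (l + i%:Z) v) (m + n - i%:Z) w *~ binz m i.
Proof.
have /(jacobi_eventually Yl Yr (va_trunc YV)) [N0 J] :=
  va_jacobi YV l m n u v w.
exists N0 => N /J; rewrite /jacobi_sum !sumrB => /eqP.
by rewrite subr_eq0 => /eqP.
Qed.

Let sum_binz0l (F : nat -> V) N :
  (0 < N)%N -> \sum_(i < N) F i *~ binz 0 i = F 0%N.
Proof.
move=> N0; rewrite (sum_ord_single (F := fun i => F i *~ binz 0 i) N0) //.
by move=> i i0; rewrite binz0l (negPf i0).
Qed.

(** At m = 0 the right-hand side of the Jacobi identity keeps only its term i = 0, a single mode of
    [Y u l v]. *)
Let sum_iterate l n u v w N : (0 < N)%N ->
  \sum_(i < N) Y (Y u (l + i%:Z) v) (0 + n - i%:Z) w *~ binz 0 i =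
  Y (Y u l v) n w.
Proof.
move=> N0.
rewrite (sum_binz0l (fun i : nat => Y (Y u (l + i%:Z) v) (0 + n - i%:Z) w)) //.
by congr (Y (Y _ _ _) _ _); lia.
Qed.

(** This is the Jacobi identity at l = 0, where [binz 0 i] leaves a single term in each sum on the
    left. *)
Lemma va_commutator m n u v w :
  exists N0, forall N, (N0 <= N)%N ->
  Y u m (Y v n w) - Y v n (Y u m w) =
  \sum_(i < N) Y (Y u i%:Z v) (m + n - i%:Z) w *~ binz m i.
Proof.
have [N0 J] := jacobi_eq 0 m n u v w; exists N0.+1 => N NN.
have N_gt0 : (0 < N)%N by lia.
transitivity (\sum_(i < N) Y (Y u (0 + i%:Z) v) (m + n - i%:Z) w *~ binz m i).
  rewrite -J ?(ltnW NN) //; congr (_ - _).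
    rewrite (eq_bigr (fun i : 'I_N =>
      Y u (m + 0 - i%:Z) (Y v (n + i%:Z) w) *~ (-1) ^+ i *~ binz 0 i)).
      rewrite (sum_binz0l (fun i : nat =>
        Y u (m + 0 - i%:Z) (Y v (n + i%:Z) w) *~ (-1) ^+ i)) //.
      by congr (Y _ _ (Y _ _ _)); lia.
    by move=> i _; rewrite mulrzA.
  rewrite (eq_bigr (fun i : 'I_N =>
    Y v (n + 0 - i%:Z) (Y u (m + i%:Z) w) *~ (-1) ^+ i *~ binz 0 i)).
    rewrite (sum_binz0l (fun i : nat =>
      Y v (n + 0 - i%:Z) (Y u (m + i%:Z) w) *~ (-1) ^+ i)) //.
    by congr (Y _ _ (Y _ _ _)); lia.
  by move=> i _; rewrite mulrzA.
by apply: eq_bigr => i _; rewrite add0r.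
Qed.

Lemma va_commutator_nat (m : nat) n u v w :
  Y u m%:Z (Y v n w) - Y v n (Y u m%:Z w) =
  \sum_(i < m.+1) Y (Y u i%:Z v) (m%:Z + n - i%:Z) w *+ 'C(m, i).
Proof.
have [N0 /(_ (N0 + m.+1)%N) ->] := va_commutator m%:Z n u v w;
  last exact: leq_addr.
apply: (sum_ord_widen (F := fun i : nat =>
  Y (Y u i%:Z v) (m%:Z + n - i%:Z) w *+ 'C(m, i))) => [|i mi].
  exact: leq_addl.
by rewrite bin_small.
Qed.

Lemma mode_der u n v : Y (va_der u) n v = - (Y u (n - 1) v *~ n).
Proof.
have [N0 J] := jacobi_eq (-2) 0 n u vac v.
pose N := (N0 + `|n| + 2)%N.
have {J} := J N; rewrite sum_iterate; last by rewrite /N; lia.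
move=> <-; last by rewrite /N; lia.
have sgn k : (-1) ^+ k * ((-1) ^+ k * k.+1%:R) = k.+1%:R :> int.
  by rewrite mulrA -exprMn mulrNN mulr1 expr1n mul1r.
(* The vacuum acts only at index -1. That index is not reached for n = 0, is reached once in the
   second sum for n = k + 1, and once in the first sum for n = -(k + 1), each time at i = k. *)
case: n @N => [[|k]|k] N.
- rewrite !big1 ?subrr ?oppr0 // => i _.
    by rewrite mode_vac ?mul0rz //; lia.
  by rewrite mode_vac ?Y0r ?mul0rz //; lia.
- rewrite big1 => [|i _]; last by rewrite mode_vac ?Y0r ?mul0rz //; lia.
  rewrite sub0r; congr (- _).
  rewrite (@sum_ord_single _ (fun i : nat => Y vac (k.+1%:Z + -2 - i%:Z)
    (Y u (0 + i%:Z) v) *~ ((-1) ^+ (`|-2 : int| + i) * binz (-2) i)) N k).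
  + rewrite (_ : _ - _ = -1); last by lia.
    rewrite mode_vacN1 binzN2 exprD sqrrN expr1n mul1r sgn natz.
    by rewrite (_ : 0 + k%:Z = k.+1%:Z - 1) //; lia.
  + by rewrite /N; lia.
  + by move=> i ik; rewrite mode_vac ?mul0rz //; lia.
- rewrite [X in _ - X]big1 => [|i _]; last by rewrite mode_vac ?mul0rz //; lia.
  rewrite subr0 (@sum_ord_single _ (fun i : nat => Y u (0 + -2 - i%:Z)
    (Y vac (Negz k + i%:Z) v) *~ ((-1) ^+ i * binz (-2) i)) N k).
  + rewrite (_ : Negz k + _ = -1); last by lia.
    rewrite mode_vacN1 binzN2 sgn natz NegzE mulrNz opprK.
    by congr (Y _ _ _ *~ _); lia.
  + by rewrite /N; lia.
  + by move=> i ik; rewrite mode_vac ?Y0r ?mul0rz //; lia.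
Qed.

(** The factorial stays on the left since K is only a ring here; it is inverted later, in
    characteristic zero. *)
Lemma iter_va_der i v : Y v (-1 - i%:Z) vac *+ i`! = iter i va_der v.
Proof.
elim: i v => [|i IH] v; first by rewrite subr0 modeN1_vac.
rewrite iterSr -IH mode_der -mulrNz opprB opprK factS mulrnA.
congr (_ *+ _); rewrite pmulrn.
by congr (Y _ _ _ *~ _); lia.
Qed.

(** Exchanging (u, m) with (v, n) changes the left-hand side of the Jacobi identity by the factor
    [- (-1)^l]. On the vacuum, with modes 0 and -1, the two right-hand sides are [Y u l v] and the
    skew expansion. *)
Lemma va_skew l u v :
  exists N0, forall N, (N0 <= N)%N ->
  Y u l v = \sum_(i < N)
    Y (Y v (l + i%:Z) u) (-1 - i%:Z) vac *~ (-1) ^+ (`|l| + i + 1).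
Proof.
have [N1 J1] := jacobi_eq l 0 (-1) u v vac.
have [N2 J2] := jacobi_eq l (-1) 0 v u vac.
exists (N1 + N2).+1 => N NN; have {J1} := J1 N; have {J2} := J2 N.
rewrite [X in _ -> (_ -> _ = X) -> _]sum_iterate; last by lia.
rewrite modeN1_vac => J2 <-; last by lia.
pose s : int := (-1) ^+ `|l|.
have ss : s * s = 1 by rewrite /s -exprMn mulrNN mulr1 expr1n.
set A := \sum_(i < N) _; set B := \sum_(i < N) _; set C := RHS.
suff: (A - B) *~ s = C *~ s.
  by move/(congr1 (fun x => x *~ s)); rewrite -!mulrzA ss !mulr1z.
transitivity (- \sum_(i < N) Y (Y v (l + i%:Z) u) (-1 + 0 - i%:Z) vac *~ binz
  (-1) i).
  rewrite -J2; last by lia.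
  rewrite opprB mulrzBl !mulrz_suml.
  congr (_ - _); apply: eq_bigr => i _; rewrite -mulrzA; congr (_ *~ _).
    by rewrite exprD mulrC mulrA.
  by rewrite exprD mulrC !mulrA ss mul1r.
rewrite /C mulrz_suml -sumrN; apply: eq_bigr => i _.
rewrite addr0 binzN1 -mulrzA -mulrNz; congr (_ *~ _).
by rewrite mulrC !exprD -/s !mulrA ss mul1r mulrN1.
Qed.

(** In the Jacobi identity for [(u_n v)_(-2) 1] the creation property leaves two terms,
    [u_n (v_(-2) 1)] and [-n u_(n-1) v]; the latter is a mode of [va_der u] by [mode_der]. *)
Lemma va_der_mode n u v : va_der (Y u n v) =
  Y (va_der u) n v + Y u n (va_der v).
Proof.
have [N0 J] := jacobi_eq n 0 (-2) u v vac.
have {J} := J N0.+2; rewrite sum_iterate; last by lia.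
rewrite [in X in _ -> X]/va_der => <-; last by lia.
rewrite [X in _ - X]big1 => [|i _]; last first.
  by rewrite [Y u _ vac]mode_nneg_vac ?Y0r ?mul0rz.
rewrite subr0 !big_ord_recl big1 => [|i _]; last first.
  by rewrite [Y v _ vac]mode_nneg_vac ?Y0r ?mul0rz //=; lia.
rewrite -/(va_der u) -/(va_der v) mode_der addrC /=.
congr (_ + _); last first.
  by rewrite binz0r mulr1; congr (Y u _ _); lia.
rewrite addr0 (_ : bump 0 0 = 1%N) // expr1 mulN1r mulrNz; congr (- (_ *~ _));
  last first.
  by case: n => [n|n] /=; rewrite !bin1 // expr1 addn1 mulN1r NegzE.
rewrite -[in RHS](modeN1_vac v); congr (Y u _ (Y v _ _)); lia.
Qed.

End VertexAlgebraIdentities.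

(** * Commutative vertex algebras and their commutative associative product *)

Section CommutativeVertexAlgebra.
Variables (K : comNzRingType) (V : lmodType K).
Variables (Y : V -> int -> V -> V) (vac : V).
Hypothesis YV : vertex_algebra Y vac.

(** The right-hand side of the commutator formula involves only the nonnegative modes [u_i v]. *)
Lemma va_commutativeI :
  (forall u v (i : nat), Y u i%:Z v = 0) -> va_commutative Y.
Proof.
move=> Y0 u v m n w; apply/eqP; rewrite -subr_eq0; apply/eqP.
have [N0 /(_ _ (leqnn _)) ->] := va_commutator YV m n u v w.
by apply: big1 => i _; rewrite Y0 (linearf0 (va_linearl YV _ _)) mul0rz.
Qed.

Hypothesis YC : va_commutative Y.

Lemma va_comm_mulC u v : Y u (-1) v = Y v (-1) u.
Proof. by rewrite -{1}(modeN1_vac YV v) YC (modeN1_vac YV). Qed.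

Lemma va_comm_mulA u v w : Y u (-1) (Y v (-1) w) = Y (Y u (-1) v) (-1) w.
Proof. by rewrite [Y v _ w]va_comm_mulC YC va_comm_mulC. Qed.

End CommutativeVertexAlgebra.

(** * The vertex Poisson algebra W/hW *)

Section QuotientPoisson.
Variables (K : fieldType) (W : lmodType {poly K}).
Hypothesis K_pchar0 : [pchar K] =i pred0.
Variables (Y : W -> int -> W -> W) (vac : W).
Hypothesis YV : vertex_algebra Y vac.
Hypothesis WX_free : forall w : W, 'X *: w = 0 -> w = 0.
Hypothesis YX : forall u v (i : nat), exists w, 'X *: w = Y u i%:Z v.

Let Yl := va_linearl YV.
Let Yr := va_linearr YV.
Let YDl n v u u' : Y (u + u') n v = Y u n v + Y u' n v.
Proof. exact: (linearfD (Yl n v)). Qed.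
Let YDr n v u u' : Y v n (u + u') = Y v n u + Y v n u'.
Proof. exact: (linearfD (Yr v n)). Qed.
Let YZl n v c u : Y (c *: u) n v = c *: Y u n v.
Proof. exact: (linearfZ (Yl n v)). Qed.
Let YZr n v c u : Y v n (c *: u) = c *: Y v n u.
Proof. exact: (linearfZ (Yr v n)). Qed.

Let Q := specialize W 'X.
Let cl : W -> Q := spec_class 'X.
Let clD u v : cl (u + v) = cl u + cl v := spec_classD _ u v.
Let clZ c u : cl (c%:P *: u) = c *: cl u := spec_classZ _ c u.
Let clX u : cl ('X *: u) = 0 := spec_classMl _ u.
Let cl_surj x : exists u, cl u = x := spec_class_surj x.

Lemma scaleX_inj : injective (fun w : W => 'X *: w).
Proof.
move=> u v /= uv; apply/eqP; rewrite -subr_eq0; apply/eqP/WX_free.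
by rewrite scalerBr uv subrr.
Qed.

(** The element [(1/h) u_i v] of W itself: it exists by [YX], so the default 0 is never an arbitrary
    choice, and it is unique because h is injective. Skew symmetry and the commutator formula hold
    for these lifts already in W; the Leibniz rule holds only modulo h. *)
Definition divX_mode (i : nat) (u v : W) : W :=
  xget 0 [set w | 'X *: w = Y u i%:Z v]%classic.

Lemma divX_modeE i u v : 'X *: divX_mode i u v = Y u i%:Z v.
Proof. exact: (xgetPex 0 (YX u v i)). Qed.

Definition quot_mul (x y : Q) : Q := spec_mode (f := 'X) Y x (-1) y.
Definition quot_der (x : Q) : Q := spec_mode (f := 'X) Y x (-2) (cl vac).
Definition quot_prod (i : nat) (x y : Q) : Q :=
  cl (divX_mode i (spec_repr x) (spec_repr y)).
Definition quot_vpa : vpa_data Q := VPAData quot_mul (cl vac) quot_der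
  quot_prod.

Lemma quot_mulE u v : quot_mul (cl u) (cl v) = cl (Y u (-1) v).
Proof. exact: (spec_mode_class 'X YV). Qed.

Lemma quot_derE u : quot_der (cl u) = cl (va_der Y vac u).
Proof. exact: (spec_mode_class 'X YV u (-2) vac). Qed.

Lemma iter_quot_derE i u : iter i quot_der (cl u) =
  cl (iter i (va_der Y vac) u).
Proof. by elim: i => //= i ->; rewrite quot_derE. Qed.

(** Independence of representatives: replacing u by [u + h a] changes [(1/h) u_i v] by [a_i v],
    which is again in hW by [YX]; likewise for v. The witness is the sum of the two corrections
    divided by h. *)
Lemma quot_prodE i u v w :
  'X *: w = Y u i%:Z v -> quot_prod i (cl u) (cl v) = cl w.
Proof.
move=> Xw; rewrite /quot_prod.
have [a ua] : exists a : W, spec_repr (cl u) - u = 'X *: a.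
  by apply/spec_classP/lreprK.
have [b vb] : exists b : W, spec_repr (cl v) - v = 'X *: b.
  by apply/spec_classP/lreprK.
apply/spec_classP; exists (divX_mode i a (spec_repr (cl v)) + divX_mode i u b).
apply: scaleX_inj; rewrite scalerBr !divX_modeE Xw.
rewrite [_ + divX_mode i u b]lock scalerA -lock scalerDr -!scalerA !divX_modeE.
move/eqP: ua; rewrite subr_eq => /eqP ->.
rewrite YDl YZl -addrA; congr (_ + _).
move/eqP: vb; rewrite subr_eq => /eqP ->.
by rewrite YDr YZr addrK.
Qed.

Lemma quot_mode_nneg (x y : Q) (i : nat) : spec_mode (f := 'X) Y x i%:Z y = 0.
Proof.
have [[u <-] [v <-]] := (cl_surj x, cl_surj y).
by rewrite (spec_mode_class 'X YV) -divX_modeE; exact: clX.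
Qed.

Let QV : vertex_algebra (spec_mode (f := 'X) Y) (cl vac) :=
  vertex_algebra_specialize 'X YV.

Lemma quot_commutative : va_commutative (spec_mode (f := 'X) Y).
Proof. exact: va_commutativeI QV quot_mode_nneg. Qed.

Let divX_prod i u v : quot_prod i (cl u) (cl v) = cl (divX_mode i u v).
Proof. exact/quot_prodE/divX_modeE. Qed.

Let divX_eq i u v w : 'X *: w = Y u i%:Z v -> divX_mode i u v = w.
Proof. by move=> Xw; apply: scaleX_inj; rewrite divX_modeE. Qed.

Lemma quot_prod_linearl n y : linear (fun x => quot_prod n x y).
Proof.
move=> c x x'.
have [[v <-] [u <-] [u' <-]] := And3 (cl_surj y) (cl_surj x) (cl_surj x').
rewrite -clZ -clD !divX_prod -clZ -clD; congr cl; apply: divX_eq.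
by rewrite YDl YZl -!divX_modeE scalerDr !scalerA [_ * 'X]mulrC.
Qed.

Lemma quot_prod_linearr n x : linear (quot_prod n x).
Proof.
move=> c y y'.
have [[v <-] [u <-] [u' <-]] := And3 (cl_surj x) (cl_surj y) (cl_surj y').
rewrite -clZ -clD !divX_prod -clZ -clD; congr cl; apply: divX_eq.
by rewrite YDr YZr -!divX_modeE scalerDr !scalerA [_ * 'X]mulrC.
Qed.

Lemma divX_mode_eventually0 u v (n : nat) :
  exists N, forall i, (N <= i)%N -> divX_mode (n + i) u v = 0.
Proof.
have [N YN] := mode_trunc (va_trunc YV) u v n%:Z; exists N => i Ni.
by apply: divX_eq; rewrite scaler0 PoszD YN.
Qed.

(** Divide [va_skew] by h and express [w_(-1-i) 1] through the i-th power of the derivation;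
    characteristic zero makes i! invertible. *)
Lemma divX_mode_skew n u v : exists N0, forall N, (N0 <= N)%N ->
  divX_mode n u v = \sum_(i < N) ((-1) ^+ (n + i + 1) * (i`!)%:R^-1)%:P *:
    iter i (va_der Y vac) (divX_mode (n + i) v u).
Proof.
have [N0 S] := va_skew YV n%:Z u v; exists N0 => N /S E.
apply: divX_eq; rewrite E scaler_sumr; apply: eq_bigr => i _.
rewrite -PoszD -divX_modeE YZl scalerMzr; congr ('X *: _).
rewrite -(iter_va_der YV) -scaler_nat scalerA -polyC_natr -polyCM -mulrA.
rewrite mulVf; last by rewrite ((pcharf0P K).1 K_pchar0) -lt0n fact_gt0.
by rewrite mulr1 polyC_exp polyCN polyC1 -scaler_int rmorphXn /= rmorphN1.
Qed.

Let divX2 m (n : nat) u v w :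
  'X *: ('X *: divX_mode m u (divX_mode n v w)) = Y u m%:Z (Y v n%:Z w).
Proof. by rewrite divX_modeE -YZr divX_modeE. Qed.

Let divX2' m (n : nat) u v w :
  'X *: ('X *: divX_mode m (divX_mode n u v) w) = Y (Y u n%:Z v) m%:Z w.
Proof. by rewrite divX_modeE -YZl divX_modeE. Qed.

Lemma divX_mode_commutator m n u v w :
  divX_mode m u (divX_mode n v w) - divX_mode n v (divX_mode m u w) =
  \sum_(i < m.+1) 'C(m, i)%:R%:P *: divX_mode (m + n - i) (divX_mode i u v) w.
Proof.
(* Each term contains two divided modes, so multiplying by h twice clears both and leaves the
   commutator formula of W. *)
apply/scaleX_inj/scaleX_inj; rewrite !scalerBr !divX2 (va_commutator_nat YV).
rewrite !scaler_sumr; apply: eq_bigr => i _.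
rewrite !scalerA [_ * _%:P]mulrC -!scalerA divX2' polyC_natr scaler_nat.
by congr (Y _ _ _ *+ _); have := ltn_ord i; lia.
Qed.

(* In the commutator formula for [u_n, v_(-1)] all the terms but one are
   divisible by h^2. *)
Lemma divX_mode_leibniz n u v w :
  cl (divX_mode n u (Y v (-1) w)) =
  cl (Y (divX_mode n u v) (-1) w) + cl (Y v (-1) (divX_mode n u w)).
Proof.
(* For i < n the outer index [n - 1 - i] is nonnegative, so these terms are h^2 times those of r.
   The term i = n has outer index -1 and is the first summand of the Leibniz rule. *)
pose r := \sum_(i < n) divX_mode (n - 1 - i) (divX_mode i u v) w *+ 'C(n, i).
rewrite -clD -[RHS]addr0 -(clX r) -clD; congr cl; apply: divX_eq.
rewrite !scalerDr -YZl -YZr !divX_modeE.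
have /eqP := va_commutator_nat YV n (-1) u v w.
rewrite subr_eq => /eqP ->; rewrite big_ord_recr /= binn mulr1n.
rewrite -[LHS]addrA [LHS]addrC [RHS]addrAC; congr (_ + _); last first.
  by congr (Y _ _ _); lia.
rewrite addrC; congr (_ + _).
rewrite !scaler_sumr; apply: eq_bigr => i _.
rewrite -!scalerMnr divX2'; congr (Y _ _ _ *+ _).
by have := ltn_ord i; lia.
Qed.

(** The algebra and its derivation come from the commutative vertex algebra W/hW. Its nonnegative
    modes vanish, so the axioms on the products are checked on the lifts [divX_mode] in W. *)
Lemma quot_vpaP : vertex_poisson_algebra quot_vpa.
Proof.
split => /=.
- by move=> y; apply: va_linearl QV _ _.
- by move=> x; apply: va_linearr QV _ _.
- exact: (va_comm_mulA QV quot_commutative).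
- exact: (va_comm_mulC QV quot_commutative).
- exact: (mode_vacN1 QV).
- split; first exact: (va_der_linear QV).
  by move=> x y; apply: (va_der_mode QV).
- split.
  + exact: (va_der_linear QV).
  + exact: quot_prod_linearl.
  + exact: quot_prod_linearr.
  + move=> x y; have [[u <-] [v <-]] := (cl_surj x, cl_surj y).
    have [N YN] := divX_mode_eventually0 u v 0; exists N => n Nn.
    by rewrite divX_prod YN // -[0](scaler0 _ 'X) clX.
  + move=> n x y; have [[u <-] [v <-]] := (cl_surj x, cl_surj y).
    rewrite quot_derE !divX_prod -scaleNr -clZ; congr cl; apply: divX_eq.
    rewrite (mode_der YV) scalerA mulrC -scalerA divX_modeE.
    rewrite polyCN polyC_natr scaleNr scaler_nat; congr (- _).
    (* At n = 0 the integer [n - 1] and the natural number [n.-1] differ, but both modes carry the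
       coefficient 0. *)
    by case: n => // n; rewrite pmulrn; congr (Y _ _ _ *~ _); lia.
  + move=> n x y; have [[u <-] [v <-]] := (cl_surj x, cl_surj y).
    have [N1 YN] := divX_mode_eventually0 v u n.
    have [N2 S] := divX_mode_skew n u v.
    rewrite (fsum_bounded (N := N1 + N2)) => [|i Ni]; last first.
      rewrite divX_prod YN; last exact: leq_trans (leq_addr _ _) Ni.
      by rewrite iter_quot_derE -(iter_va_der YV) (linearf0 (Yl _ _)) mul0rn
                 -[0](scaler0 _ 'X) clX !scaler0.
    rewrite divX_prod (S (N1 + N2)%N) ?leq_addl // [LHS]raddf_sum.
    by apply: eq_bigr => i _; rewrite [LHS]clZ divX_prod iter_quot_derE scalerA.
  + move=> m n x y z.
    have [[u <-] [v <-] [w <-]] := And3 (cl_surj x) (cl_surj y) (cl_surj z).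
    rewrite !divX_prod -[LHS]raddfB divX_mode_commutator [LHS]raddf_sum.
    by apply: eq_bigr => i _; rewrite [LHS]clZ !divX_prod.
- move=> n x; split; first exact: quot_prod_linearr.
  move=> y z.
  have [[u <-] [v <-] [w <-]] := And3 (cl_surj x) (cl_surj y) (cl_surj z).
  by rewrite !(quot_mulE, divX_prod) divX_mode_leibniz.
Qed.

Lemma quot_vpa_structure : quotient_structure Y vac quot_vpa.
Proof.
split=> //; first exact: quot_vpaP.
- exact: quot_mulE.
- exact: quot_derE.
- by move=> i u v w; apply: quot_prodE.
Qed.

End QuotientPoisson.

Lemma finite_set_natP (A : set nat) :
  finite_set A <-> exists N, forall i, A i -> (i < N)%N.
Proof.
split=> [/finite_seqP [s ->]|[N AN]].
  exists (\max_(i <- s) i).+1 => i /= si; rewrite ltnS.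
  exact: (@leq_bigmax_seq _ _ xpredT id).
exact: sub_finite_set AN (finite_II N).
Qed.

Lemma poly_linearI (K : nzRingType) (U W : lmodType {poly K}) (f : U -> W) :
  (forall u v, f (u + v) = f u + f v) ->
  (forall c u, f (c%:P *: u) = c%:P *: f u) ->
  (forall u, f ('X *: u) = 'X *: f u) -> linear f.
Proof.
move=> fD fC fX; apply: linearP_gen => // p; elim/poly_ind: p => [|p c IH] u.
  by rewrite -polyC0 fC.
by rewrite !scalerDl fD fC -!scalerA IH fX.
Qed.

(** * The module V[h] *)

Section VPoly.
Variables (K : comNzRingType) (V : lmodType K).
Implicit Types (f g : vpoly V) (u v : V).

Lemma vcoef_bounded f : exists N, forall i, (N <= i)%N -> vcoef f i = 0.
Proof.
have /finite_set_natP [N fN] := dsum_fin f; exists N => i Ni.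
by apply/eqP; apply: contraLR Ni => /fN; rewrite -ltnNge.
Qed.

Lemma finite_supp_bounded (F : nat -> V) :
  (exists N, forall i, (N <= i)%N -> F i = 0) ->
  finite_supp (A := fun _ : nat => V) F.
Proof.
move=> [N FN]; apply/asboolP/finite_set_natP; exists N => i /= Fi.
by rewrite ltnNge; apply: contraNN Fi => /FN ->.
Qed.

Lemma vcoefX f i : vcoef ('X *: f) i = if i is j.+1 then vcoef f j else 0.
Proof.
rewrite vcoef_scale; case: i => [|i].
  by rewrite big_ord1 coefX scale0r.
rewrite (sum_ord_single (F := fun j => 'X`_j *: vcoef f (i.+1 - j)) (j :=
  1)) //.
  by rewrite coefX scale1r subn1.
by move=> j j1; rewrite coefX (negPf j1) scale0r.
Qed.

Lemma vcoefC c f i : vcoef (c%:P *: f) i = c *: vcoef f i.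
Proof.
rewrite vcoef_scale.
rewrite (sum_ord_single (F := fun j => c%:P`_j *: vcoef f (i - j)) (j :=
  0%N)) //.
  by rewrite coefC subn0.
by move=> j j0; rewrite coefC (negPf j0) scale0r.
Qed.

Lemma vcoefXn n f i :
  vcoef ('X^n *: f) i = if (i < n)%N then 0 else vcoef f (i - n).
Proof.
elim: n i => [|n IH] i; first by rewrite scale1r subn0.
by rewrite exprS -scalerA vcoefX; case: i => [//|i]; rewrite IH.
Qed.

Lemma vcoef_const v i : vcoef (vconst v) i = if i == 0%N then v else 0.
Proof.
rewrite -[LHS]/(dfwith (fun _ : nat => 0 : V) v i); case: eqVneq => [->|i0];
  first by rewrite dfwith_in.
by rewrite dfwith_out // eq_sym.
Qed.

Lemma vcoefB f g i : vcoef (f - g) i = vcoef f i - vcoef g i.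
Proof. by []. Qed.

Lemma vconstD u v : vconst (u + v) = vconst u + vconst v.
Proof.
apply: vpolyP => i; rewrite vcoefD !vcoef_const.
by case: eqP => // _; rewrite addr0.
Qed.

Lemma vconstZ c v : vconst (c *: v) = c%:P *: vconst v.
Proof.
apply: vpolyP => i; rewrite vcoefC !vcoef_const.
by case: eqP => // _; rewrite scaler0.
Qed.

Fact vconst_zmod : zmod_morphism (@vconst K V).
Proof. by move=> u v; rewrite vconstD -scaleN1r vconstZ polyCN scaleN1r. Qed.
HB.instance Definition _ :=
  GRing.isZmodMorphism.Build V (vpoly V) (@vconst K V) vconst_zmod.

Fact vshift_fin f : finite_supp (A := fun _ : nat => V) (fun i => vcoef f i.+1).
Proof.
apply: finite_supp_bounded; have [N fN] := vcoef_bounded f.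
by exists N => i Ni; apply/fN/leqW.
Qed.
Definition vshift f : vpoly V := DSum (vshift_fin f).

Lemma vpoly_recl f : f = vconst (vcoef f 0) + 'X *: vshift f.
Proof.
apply: vpolyP => -[|i]; rewrite vcoefD vcoefX vcoef_const /=.
  by rewrite addr0.
by rewrite add0r.
Qed.

(** Splitting off the constant term and dividing the rest by h lowers the degree bound by one. *)
Lemma vpoly_ind (P : vpoly V -> Prop) :
  (forall f g, P f -> P g -> P (f + g)) -> (forall f, P f -> P ('X *: f)) ->
  (forall v, P (vconst v)) -> forall f, P f.
Proof.
move=> PD PX PC f; have [N] := vcoef_bounded f; elim: N f => [|N IH] f fN.
  have -> : f = vconst 0 by apply: vpolyP => i;
    rewrite fN // vcoef_const if_same.
  exact: PC.
rewrite [f]vpoly_recl; apply: PD => //; apply/PX/IH => i Ni.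
exact: (fN i.+1).
Qed.

Lemma vpoly_scaleX_eq0 f : 'X *: f = 0 -> f = 0.
Proof.
by move=> Xf; apply: vpolyP => i; rewrite -[vcoef f i](vcoefX f i.+1) Xf.
Qed.

End VPoly.

(** * The K[h]-bilinear extension of Y to V[h] *)

Section VPolyVertexAlgebra.
Variables (K : comNzRingType) (V : lmodType K).
Variables (Y : V -> int -> V -> V) (vac : V).
Hypothesis YV : vertex_algebra Y vac.

Let Y0l n v : Y 0 n v = 0. Proof. exact: (linearf0 (va_linearl YV n v)). Qed.
Let Y0r u n : Y u n 0 = 0. Proof. exact: (linearf0 (va_linearr YV u n)). Qed.

Fact vpoly_mode_fin (f : vpoly V) (r : int) (g : vpoly V) :
  finite_supp (A := fun _ : nat => V)
    (fun k => \sum_(i < k.+1) Y (vcoef f i) r (vcoef g (k - i))).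
Proof.
apply: finite_supp_bounded.
have [[N fN] [M gM]] := (vcoef_bounded f, vcoef_bounded g).
exists (N + M)%N => k NMk; apply: big1 => i _.
have [Ni|iN] := leqP N i; first by rewrite fN // Y0l.
by rewrite gM ?Y0r //; lia.
Qed.
Definition vpoly_mode f r g : vpoly V := DSum (vpoly_mode_fin f r g).

Lemma vcoef_mode f r g k : vcoef (vpoly_mode f r g) k =
  \sum_(i < k.+1) Y (vcoef f i) r (vcoef g (k - i)).
Proof. by []. Qed.

Lemma vcoef_mode_rev f r g k : vcoef (vpoly_mode f r g) k =
  \sum_(i < k.+1) Y (vcoef f (k - i)) r (vcoef g i).
Proof.
rewrite vcoef_mode (reindex_inj rev_ord_inj) /=; apply: eq_bigr => i _.
by rewrite subKn // -ltnS.
Qed.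

Lemma vpoly_mode_linearl r g : linear (fun f => vpoly_mode f r g).
Proof.
apply: poly_linearI => [f f'|c f|f]; apply: vpolyP => k.
- rewrite vcoefD !vcoef_mode -big_split; apply: eq_bigr => i _.
  by rewrite vcoefD (linearfD (va_linearl YV _ _)).
- rewrite vcoefC !vcoef_mode scaler_sumr; apply: eq_bigr => i _.
  by rewrite vcoefC (linearfZ (va_linearl YV _ _)).
- rewrite vcoefX vcoef_mode big_ord_recl vcoefX Y0l add0r.
  by case: k => [|k]; rewrite ?big_ord0 //; apply: eq_bigr => i _;
    rewrite vcoefX.
Qed.

Lemma vpoly_mode_linearr f r : linear (vpoly_mode f r).
Proof.
apply: poly_linearI => [g g'|c g|g]; apply: vpolyP => k.
- rewrite vcoefD !vcoef_mode -big_split; apply: eq_bigr => i _.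
  by rewrite vcoefD (linearfD (va_linearr YV _ _)).
- rewrite vcoefC !vcoef_mode scaler_sumr; apply: eq_bigr => i _.
  by rewrite vcoefC (linearfZ (va_linearr YV _ _)).
- rewrite vcoefX vcoef_mode_rev big_ord_recl vcoefX Y0r add0r.
  case: k => [|k]; rewrite ?big_ord0 // vcoef_mode_rev.
  by apply: eq_bigr => i _; rewrite vcoefX.
Qed.

Lemma vpoly_mode_const u r v : vpoly_mode (vconst u) r (vconst v) =
  vconst (Y u r v).
Proof.
apply: vpolyP => k; rewrite vcoef_mode big_ord_recl big1 => [|i _]; last first.
  by rewrite vcoef_const /= Y0l.
rewrite addr0 subn0 !vcoef_const /=; case: ifP => //; by rewrite Y0r.
Qed.

Let Ml := vpoly_mode_linearl.
Let Mr := vpoly_mode_linearr.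

(** By linearity every axiom reduces to constants, where it is the axiom for Y. Truncation bounds
    and Jacobi thresholds may depend on the arguments, so they survive sums and multiplication by
    h. *)
Lemma vpoly_vertex_algebra : vertex_algebra vpoly_mode (vconst vac).
Proof.
have Mt f g : exists N : int, forall n, N <= n -> vpoly_mode f n g = 0.
  elim/vpoly_ind: f g => [f f' IHf IHf' g|f IHf g|u g].
  - have [[N YN] [N' YN']] := (IHf g, IHf' g).
    exists (`|N| + `|N'|)%N%:Z => n Nn.
    by rewrite (linearfD (Ml n g)) YN ?YN' ?addr0 //; lia.
  - have [N YN] := IHf g; exists N => n Nn.
    by rewrite (linearfZ (Ml n g)) YN // scaler0.
  elim/vpoly_ind: g => [g g' [N YN] [N' YN']|g [N YN]|v].
  - exists (`|N| + `|N'|)%N%:Z => n Nn.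
    by rewrite (linearfD (Mr _ n)) YN ?YN' ?addr0 //; lia.
  - by exists N => n Nn; rewrite (linearfZ (Mr _ n)) YN // scaler0.
  have [N YN] := va_trunc YV u v.
  by exists N => n Nn; rewrite vpoly_mode_const YN // raddf0.
apply: vertex_algebra_eventually => //.
- move=> n; elim/vpoly_ind => [f g IHf IHg|f IHf|v].
  + by rewrite (linearfD (Mr _ n)) IHf IHg; case: ifP => //; rewrite addr0.
  + by rewrite (linearfZ (Mr _ n)) IHf; case: ifP => //; rewrite scaler0.
  + by rewrite vpoly_mode_const (va_vacuum YV); case: ifP => //; rewrite raddf0.
- elim/vpoly_ind => [f g [IHf1 IHf] [IHg1 IHg]|f [IHf1 IHf]|v].
  + rewrite (linearfD (Ml _ _)) IHf1 IHg1; split => // n n0.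
    by rewrite (linearfD (Ml _ _)) IHf ?IHg ?addr0.
  + rewrite (linearfZ (Ml _ _)) IHf1; split => // n n0.
    by rewrite (linearfZ (Ml _ _)) IHf ?scaler0.
  + have [v1 v0] := va_creation YV v.
    by split=> [|n n0]; rewrite vpoly_mode_const ?v1 // v0 ?raddf0.
move=> l m n u v w.
have J1 := jacobi_sum_linear1 Ml Mr l m n;
  have J2 := jacobi_sum_linear2 Ml Mr l m n.
have J3 := jacobi_sum_linear3 Mr l m n.
elim/vpoly_ind: u => [u u' [N YN] [N' YN']|u [N YN]|u].
- exists (N + N')%N => k Nk.
  by rewrite (linearfD (J1 v w k)) YN ?YN' ?addr0 //; lia.
- by exists N => k Nk; rewrite (linearfZ (J1 v w k)) YN ?scaler0.
elim/vpoly_ind: v => [v v' [N YN] [N' YN']|v [N YN]|v].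
- exists (N + N')%N => k Nk.
  by rewrite (linearfD (J2 _ w k)) YN ?YN' ?addr0 //; lia.
- by exists N => k Nk; rewrite (linearfZ (J2 _ w k)) YN ?scaler0.
elim/vpoly_ind: w => [w w' [N YN] [N' YN']|w [N YN]|w].
- exists (N + N')%N => k Nk.
  by rewrite (linearfD (J3 _ _ k)) YN ?YN' ?addr0 //; lia.
- by exists N => k Nk; rewrite (linearfZ (J3 _ _ k)) YN ?scaler0.
have /(jacobi_eventually _ _ _) [] := va_jacobi YV l m n u v w.
- exact: va_linearl YV.
- exact: va_linearr YV.
- exact: va_trunc YV.
move=> N0 J; exists N0 => N /J E.
have Yc a k b : vconst (Y a k b) = vpoly_mode (vconst a) k (vconst b).
  by rewrite vpoly_mode_const.
by rewrite -(jacobi_sum_hom Yc) E raddf0.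
Qed.

End VPolyVertexAlgebra.

Lemma inj_surj_bij (A B : Type) (f : A -> B) :
  injective f -> (forall y, exists x, f x = y) -> bijective f.
Proof.
move=> f_inj f_surj; pose g y := projT1 (cid (f_surj y)).
have gK : cancel g f by move=> y; apply: (projT2 (cid (f_surj y))).
by exists g => // x; apply: f_inj; rewrite gK.
Qed.

(** * V as V[h]/hV[h] and as V[h]/(h-1)V[h] *)

Section SpecializeConstants.
Variables (K : comNzRingType) (V : lmodType K).

Lemma spec_const_linear (q : {poly K}) :
  linear (fun v : V => spec_class q (vconst v)).
Proof. by move=> c u v; rewrite vconstD vconstZ spec_classD spec_classZ. Qed.

Lemma spec_constX_bij : bijective (fun v : V => spec_class 'X (vconst v)).
Proof.
apply: inj_surj_bij => [u v /spec_classP [w uv]|x].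
  apply/eqP; rewrite -subr_eq0; have := congr1 (fun f => vcoef f 0) uv.
  by rewrite vcoefX -(raddfB (@vconst K V)) vcoef_const => /= ->.
have [f <-] := spec_class_surj x; exists (vcoef f 0).
by rewrite [in RHS](vpoly_recl f) spec_classD spec_classMl addr0.
Qed.

Lemma spec_classXn (W : lmodType {poly K}) n (w : W) :
  spec_class ('X - 1) ('X^n *: w) = spec_class ('X - 1) w.
Proof.
elim: n => [|n IH]; first by rewrite scale1r.
rewrite exprS -scalerA -{}IH; set u := 'X^n *: w.
by apply/spec_classP; exists u; rewrite scalerBl scale1r.
Qed.

Lemma spec_constX1_bij : bijective (fun v : V =>
  spec_class ('X - 1) (vconst v)).
Proof.
apply: inj_surj_bij => [u v /spec_classP [w uv]|x].
  (* From [u - v = (h - 1) w] the coefficients of w are all equal; as almost all of them vanish, w =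
     0. *)
  have E i : vcoef w i.+1 = vcoef w i.
    have := congr1 (fun f => vcoef f i.+1) uv.
    rewrite -(raddfB (@vconst K V)) vcoef_const /= scalerBl scale1r =>
      /esym/eqP.
    by rewrite vcoefB vcoefX subr_eq0 eq_sym => /eqP.
  have [N wN] := vcoef_bounded w.
  have w0 : vcoef w 0 = 0.
    have : vcoef w N = 0 by apply: wN.
    by elim: (N) => // n IH; rewrite E.
  have := congr1 (fun f => vcoef f 0) uv.
  rewrite -(raddfB (@vconst K V)) vcoef_const /= scalerBl scale1r.
  rewrite vcoefB vcoefX w0 subr0.
  by move/eqP; rewrite subr_eq0 => /eqP.
have [f <-] := spec_class_surj x;
  elim/vpoly_ind: f {x} => [f g [u uf] [v vg]|f [u uf]|v].
- by exists (u + v); rewrite vconstD !spec_classD uf vg.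
- by exists u; rewrite uf -(spec_classXn 1 f) expr1.
- by exists v.
Qed.

End SpecializeConstants.

(** * Transport of a vertex Poisson structure along a linear bijection *)

Section Transport.
Variables (K : fieldType) (A B : lmodType K) (T : vpa_data B).
Variables (f : A -> B) (g : B -> A).
Hypotheses (f_lin : linear f) (fK : cancel f g) (gK : cancel g f).
Hypothesis T_vpa : vertex_poisson_algebra T.

Definition transport_vpa : vpa_data A :=
  VPAData (fun a b => g (vp_mul T (f a) (f b))) (g (vp_one T))
    (fun a => g (vp_der T (f a))) (fun n a b => g (vp_prod T n (f a) (f b))).

Let f_inj : injective f := can_inj fK.

Lemma transport_vpa_isomorphism : vpa_isomorphism transport_vpa T f.
Proof. by split=> //= *; rewrite ?gK //; split=> //; exists g. Qed.

Lemma transport_vpaP : vertex_poisson_algebra transport_vpa.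
Proof.
have [[Dl DM] L] := (vp_der_derivation T_vpa, vp_lie T_vpa).
split=> /=.
- by move=> b c u v /=; apply: f_inj; rewrite !(f_lin, gK) (vp_linearl T_vpa).
- by move=> a c u v /=; apply: f_inj; rewrite !(f_lin, gK) (vp_linearr T_vpa).
- by move=> a b c /=; apply: f_inj; rewrite !gK (vp_mulA T_vpa).
- by move=> a b /=; apply: f_inj; rewrite !gK (vp_mulC T_vpa).
- by move=> a /=; apply: f_inj; rewrite !gK (vp_mul1 T_vpa).
- split=> [c u v|a b]; apply: f_inj; first by rewrite !(f_lin, gK) Dl.
  by rewrite (linearfD f_lin) !gK DM.
- have iterE i a : f (iter i (fun a => g (vp_der T (f a))) a) =
  iter i (vp_der T) (f a).
    by elim: i => //= i IH; rewrite gK IH.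
  split.
  + by move=> c u v; apply: f_inj; rewrite !(f_lin, gK) Dl.
  + by move=> n b c u v; apply: f_inj; rewrite !(f_lin, gK) (vl_linearl L).
  + by move=> n a c u v; apply: f_inj; rewrite !(f_lin, gK) (vl_linearr L).
  + move=> a b; have [N TN] := vl_C0 L (f a) (f b); exists N => n Nn.
    by apply: f_inj; rewrite gK TN // (linearf0 f_lin).
  + move=> n a b; apply: f_inj.
    by rewrite gK gK (vl_C1 L) (linearfN f_lin) (linearfZ f_lin) gK.
  + move=> n a b; apply: f_inj; rewrite gK (vl_C2 L).
    have [N TN] := vl_C0 L (f b) (f a).
    have D0 i : iter i (vp_der T) 0 = 0.
      by elim: i => //= i ->; apply: (linearf0 Dl).
    have g0 : g 0 = 0 by apply: f_inj; rewrite gK (linearf0 f_lin).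
    rewrite !(fsum_bounded (N := N)) => [|i Ni|i Ni].
    * rewrite (linearf_sum f_lin); apply: eq_bigr => i _.
      by rewrite !(linearfZ f_lin) iterE gK.
    * apply: f_inj; rewrite !(linearfZ f_lin) iterE gK TN ?D0 ?(linearf0
      f_lin) ?scaler0 //.
      exact: leq_trans Ni (leq_addl _ _).
    * by rewrite TN ?D0 ?scaler0 // (leq_trans Ni) ?leq_addl.
  + move=> m n a b c; apply: f_inj; rewrite (linearfB f_lin) !gK (vl_C3 L).
    rewrite (linearf_sum f_lin); apply: eq_bigr => i _.
    by rewrite (linearfZ f_lin) !gK.
- move=> n a; have [Pl PM] := vp_prod_derivation T_vpa n (f a).
  split=> [c u v|b c]; apply: f_inj; first by rewrite !(f_lin, gK) Pl.
  by rewrite (linearfD f_lin) !gK PM.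
Qed.

End Transport.

(** * The associated graded space *)

Section Graded.
Variables (K : fieldType) (V : lmodType K).
Variables (E : int -> submodClosed V).

(** The homogeneous component of [gr_class]. Outside [E n] it takes the class of 0, whence the
    membership hypotheses below. *)
Definition piece_class (n : int) (v : V) : gr_piece E n :=
  lclass (@gr_sub K V E n) (insubd (0 : subspace (E n)) v).

Lemma piece_classP n u v : u \in E n -> v \in E n ->
  piece_class n u = piece_class n v <-> u - v \in E (n - 1).
Proof.
move=> Eu Ev; have <- : ((insubd 0 u - insubd 0 v : subspace (E n))
    \in @gr_sub K V E n) = (u - v \in E (n - 1)).
  by rewrite in_gr_sub raddfB /= !insubdK.
exact: lclassP.
Qed.

Lemma piece_classL n c u v : u \in E n -> v \in E n ->
  piece_class n (c *: u + v) = c *: piece_class n u + piece_class n v.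
Proof.
move=> Eu Ev; rewrite /piece_class -lclassZ -lclassD; congr lclass.
have valL (x y : subspace (E n)) : val (c *: x + y) = c *: val x + val y.
  by rewrite raddfD /= [X in X + _](_ : _ = c *: val x) //; apply: linearZ.
apply: val_inj; rewrite valL !insubdK //.
by apply: rpredD => //; apply: rpredZ.
Qed.

Lemma piece_class0 n : piece_class n 0 = 0.
Proof.
have E0 : 0 \in E n by apply: rpred0.
by have := piece_classL (-1) E0 E0; rewrite scaler0 addr0 scaleN1r addNr.
Qed.

Lemma piece_class_surj n (x : gr_piece E n) :
  exists2 v, v \in E n & piece_class n v = x.
Proof.
exists (val (lrepr x)); first exact: (valP (lrepr x)).
by rewrite /piece_class valKd; apply: lreprK.
Qed.

Definition gr_coef (x : gr E) (n : int) : gr_piece E n := dsum_fun x n.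

Lemma gr_coefP (x y : gr E) : (forall n, gr_coef x n = gr_coef y n) -> x = y.
Proof. exact: dsumP. Qed.

Lemma gr_class_in n v : gr_coef (gr_class E n v) n = piece_class n v.
Proof. exact: dfwith_in. Qed.

Lemma gr_class_out m n v : m != n -> gr_coef (gr_class E m v) n = 0.
Proof. by move=> mn; apply: dfwith_out. Qed.

Lemma gr_class0 n : gr_class E n 0 = 0.
Proof.
apply: gr_coefP => m; case: (eqVneq n m) => [<-|nm];
  last by rewrite gr_class_out.
by rewrite gr_class_in piece_class0.
Qed.

End Graded.

Lemma submodN (K : pzRingType) (V : lmodType K) (S : submodClosed V) u :
  u \in S -> - u \in S.
Proof. by rewrite -scaleN1r; apply: rpredZ. Qed.

Lemma submodB (K : pzRingType) (V : lmodType K) (S : submodClosed V) u v :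
  u \in S -> v \in S -> u - v \in S.
Proof. by move=> Su Sv; apply: rpredD (submodN Sv). Qed.

(** * Decomposition of a filtered space along complements, and the Rees map *)

Section Filtration.
Variables (K : fieldType) (V : lmodType K).
Variables (E : int -> submodClosed V) (U : nat -> submodClosed V).
Hypothesis E_exhaustive : forall v, exists n, v \in E n.
Hypothesis E_incr : forall m n : int, m <= n -> {subset E m <= E n}.
Hypothesis E_neg : forall n : int, n < 0 -> forall v, v \in E n -> v = 0.
Hypothesis EU : forall n : nat, direct_complement (E n%:Z) (E (n%:Z - 1)) (U n).

Lemma complement_sub n : {subset U n <= E n%:Z}.
Proof. by move=> u Uu; apply/(EU n).1; exists u => //; exists 0;
  rewrite ?rpred0 ?addr0. Qed.

(** The bound is [N - 1] so that N counts the components in U_0, ..., U_(N-1), and N = 0 means v = 0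
    because [E_(-1)] vanishes. *)
Lemma filtration_nat v : exists N : nat, v \in E (N%:Z - 1).
Proof.
by have [n nv] := E_exhaustive v; exists `|n|.+1; apply: E_incr nv; lia.
Qed.

Lemma filtration_sum_ex (N : nat) v : v \in E (N%:Z - 1) -> exists s : nat -> V,
  [/\ forall i, s i \in U i, forall i, (N <= i)%N -> s i = 0 &
      v = \sum_(i < N) s i].
Proof.
elim: N v => [|N IH] v Ev.
  exists (fun=> 0); split=> [i|//|]; first exact: rpred0.
  by rewrite big_ord0; apply: E_neg Ev.
have {Ev} : v \in E N%:Z by move: Ev; rewrite intS [1 + _]addrC addrK.
move/(EU N).1 => [u Uu [w /IH [s [Us s0 ->]] ->]].
exists (fun i => if i == N then u else s i); split=> [i|i Ni|].
- by case: eqP => [->|].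
- by rewrite gtn_eqF // s0 // ltnW.
rewrite big_ord_recr /= eqxx addrC; congr (_ + _).
by apply: eq_bigr => i _; rewrite ltn_eqF.
Qed.

Lemma complement_sum_in (N : nat) s :
  (forall i, s i \in U i) -> \sum_(i < N) s i \in E (N%:Z - 1).
Proof.
move=> Us; apply: rpred_sum => i _.
have Ni := ltn_ord i; apply: (E_incr _ (complement_sub (Us i))); lia.
Qed.

(** The top term is minus the sum of the lower ones, which lies in the previous step of the
    filtration and so meets the complement only in 0; then induct. *)
Lemma complement_sum_eq0 (N : nat) s : (forall i, s i \in U i) ->
  \sum_(i < N) s i = 0 -> forall i, (i < N)%N -> s i = 0.
Proof.
move=> Us; elim: N => [//|N IH]; rewrite big_ord_recr /= => sum0.
have sN : s N = 0.
  apply: (EU N).2 => //; rewrite -[s N]opprK; apply: submodN.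
  by move/eqP: sum0; rewrite addr_eq0 => /eqP <-; apply: complement_sum_in.
move=> i; rewrite ltnS leq_eqVlt => /predU1P [->//|]; apply: IH.
by move: sum0; rewrite sN addr0.
Qed.

Lemma filtration_direct_sum : internal_direct_sum U.
Proof.
move=> v; have [N Nv] := filtration_nat v.
have [s [Us s0 vs]] := filtration_sum_ex Nv; exists s; split.
  split=> //; last by rewrite (fsum_bounded s0).
  apply/finite_set_natP; exists N => i /=; apply: contraNT.
  by rewrite -leqNgt => /s0 ->.
move=> t [Ut /finite_set_natP [M tM] vt].
have t0 i : (M <= i)%N -> t i = 0.
  by move=> Mi; apply/eqP; apply: contraLR Mi => /tM; rewrite -ltnNge.
apply: funext => i; apply/eqP; rewrite -subr_eq0; apply/eqP.
(* The range covers both supports and the index i. *)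
have := @complement_sum_eq0 (N + M + i.+1) (fun j => s j - t j).
move=> /(_ _ _ i _); apply; last by rewrite leq_addl.
  by move=> j; apply: submodB.
rewrite sumrB (sum_ord_widen _ s0) -?vs; last by lia.
rewrite (sum_ord_widen _ t0); last by lia.
by rewrite -(fsum_bounded t0) -vt subrr.
Qed.

Variable p : nat -> {linear V -> V}.
Hypothesis pU : projections U p.

(** The maps p are known only on the complements, but linearity and the existence of a decomposition
    force [p i v] to be the i-th component. *)
Lemma filtration_sum (N : nat) v : v \in E (N%:Z - 1) ->
  [/\ forall i, p i v \in U i, forall i, (N <= i)%N -> p i v = 0 &
      v = \sum_(i < N) p i v].
Proof.
move=> /filtration_sum_ex [s [Us s0 vs]].
have ps i : p i v = s i.
  rewrite vs raddf_sum /=; have [Ni|iN] := leqP N i.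
    rewrite s0 // big1 // => j _.
    by rewrite (pU _ (Us j)) gtn_eqF // (leq_trans (ltn_ord j)).
  rewrite (sum_ord_single (F := fun j => p i (s j)) iN) ?(pU _ (Us i)) ?eqxx //.
  by move=> j ji; rewrite (pU _ (Us j)) eq_sym (negPf ji).
split=> [i|i|]; rewrite ?ps //; first exact: s0.
by rewrite [LHS]vs; apply: eq_bigr => i _; rewrite ps.
Qed.

Lemma proj_in i v : p i v \in U i.
Proof. by have [N /filtration_sum []] := filtration_nat v. Qed.

Lemma proj_proj i j v : p i (p j v) = if i == j then p j v else 0.
Proof. exact: pU (proj_in j v). Qed.

Lemma proj_eq0 v : (forall i, p i v = 0) -> v = 0.
Proof.
move=> pv0; have [N /filtration_sum [_ _ ->]] := filtration_nat v.
by apply: big1 => i _; rewrite pv0.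
Qed.

Lemma filtration_proj0 (n : nat) v : v \in E (n%:Z - 1) -> p n v = 0.
Proof. by move=> /filtration_sum [_ + _]; apply. Qed.

Lemma sum_proj (n : nat) v : v \in E n%:Z -> \sum_(i < n.+1) p i v = v.
Proof.
by move=> Ev; apply/esym; case: (@filtration_sum n.+1 v) => //;
  rewrite intS addrC addKr.
Qed.

Lemma proj_compl (n : nat) v : v \in E n%:Z -> v - p n v \in E (n%:Z - 1).
Proof.
move=> Ev; have PS := sum_proj Ev; rewrite -{1}PS big_ord_recr /= addrK.
by apply: (@complement_sum_in n (fun i => p i v)) => i; apply: proj_in.
Qed.

Lemma complement_ind (P : V -> Prop) :
  (forall u v, P u -> P v -> P (u + v)) ->
  (forall m u, u \in U m -> P u) -> forall v, P v.
Proof.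
move=> PD PU v; have [N /filtration_sum [_ _ ->]] := filtration_nat v.
elim/big_ind: _ => //; first by apply: (PU 0%N); exact: rpred0.
by move=> i _; apply: PU (proj_in i v).
Qed.

(** Since [gr E] is indexed by all integers, the projections are extended by 0 to negative degrees,
    where the filtration vanishes. *)
Let pz (n : int) (v : V) : V := if n is Posz k then p k v else 0.

Let pz_in n v : pz n v \in E n.
Proof. by case: n => k; [apply: complement_sub;
  apply: proj_in|apply: rpred0]. Qed.

Fact gr_split_fin v : finite_supp (fun n => piece_class E n (pz n v)).
Proof.
have [N Nv] := filtration_nat v.
have [_ v0 _] := filtration_sum Nv.
apply/asboolP; apply: (@sub_finite_set _ _ (Posz @` `I_N)%classic); last first.
  exact/finite_image/finite_II.
move=> [k|k] /=; last by rewrite piece_class0 eqxx.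
move=> nz; exists k => //=; rewrite ltnNge; apply: contraNN nz => /v0 ->.
by rewrite piece_class0.
Qed.

(* v |-> \sum_n (p_n v + E_(n-1)) *)
Definition gr_split (v : V) : gr E := DSum (gr_split_fin v).

Let gr_split_coef v n : gr_coef (gr_split v) n = piece_class E n (pz n v).
Proof. by []. Qed.

Lemma gr_split_linear : linear gr_split.
Proof.
move=> c u v; apply: gr_coefP => n; rewrite gr_split_coef.
transitivity (piece_class E n (c *: pz n u + pz n v)); last exact: piece_classL.
congr (piece_class E _ _).
by case: n => k /=; rewrite ?linearP // scaler0 addr0.
Qed.

Lemma gr_split_proj (m : nat) v : v \in E m%:Z -> gr_split (p m v) =
  gr_class E m%:Z v.
Proof.
move=> Ev; apply: gr_coefP => n; rewrite gr_split_coef.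
have ppv : p m (p m v) = p m v by rewrite (pU _ (proj_in m v)) eqxx.
case: (eqVneq m%:Z n) => [<-|mn].
  rewrite gr_class_in; apply/piece_classP => //.
  rewrite /= ppv -opprB; apply: submodN.
  exact: proj_compl Ev.
rewrite gr_class_out //; case: n mn => [k|k] mk /=; last exact: piece_class0.
by rewrite (pU _ (proj_in m v)) eq_sym -eqz_nat (negPf mk) piece_class0.
Qed.

Lemma gr_split_bij : bijective gr_split.
Proof.
apply: inj_surj_bij => [u v uv|x].
  (* Equal classes put [p k u - p k v] in [E_(k-1)], which [p k] kills, whereas [p k] fixes this
     difference. *)
  apply/eqP; rewrite -subr_eq0; apply/eqP/proj_eq0 => k; rewrite raddfB.
  have : piece_class E k%:Z (pz k%:Z u) = piece_class E k%:Z (pz k%:Z v).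
    exact: (congr1 (fun x : gr E => gr_coef x k%:Z) uv).
  move/piece_classP => /(_ (pz_in _ _) (pz_in _ _)) /filtration_proj0 /=.
  by rewrite raddfB /= !(pU _ (proj_in k _)) eqxx.
have [w wE wx] : exists2 w : nat -> V, forall k : nat, w k \in E k%:Z &
    forall k : nat, piece_class E k%:Z (w k) = gr_coef x k%:Z.
  have H (k : nat) : {v | v \in E k%:Z & piece_class E k%:Z v = gr_coef x k%:Z}.
    exact/cid2/piece_class_surj.
  by exists (fun k => s2val (H k)) => k;
    [apply: (s2valP (H k))|apply: (s2valP' (H k))].
have [N xN] : exists N, forall k, (N <= k)%N -> gr_coef x k%:Z = 0.
  have /(finite_image absz)/finite_set_natP [N xN] := dsum_fin x.
  exists N => k Nk; apply/eqP; apply: contraLR Nk => xk.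
  by rewrite -ltnNge; apply: xN; exists k%:Z.
(* The preimage adds up the leading components of representatives. From degree N on, the
   representative has class 0, so its leading component is 0 and nothing is lost. *)
exists (\sum_(k < N) p k (w k)); apply: gr_coefP => -[k|k]; last first.
  have [v vE <-] := piece_class_surj (gr_coef x (Negz k)).
  by rewrite (E_neg _ vE).
have pk : p k (\sum_(k < N) p k (w k)) = p k (w k).
  rewrite raddf_sum /=; have [Nk|kN] := leqP N k.
    rewrite [RHS]filtration_proj0; last first.
      rewrite -[w k]subr0; apply/piece_classP; rewrite ?rpred0 //.
      by rewrite wx xN // piece_class0.
    rewrite big1 // => j _; rewrite (pU _ (proj_in j _)) gtn_eqF //.
    exact: leq_trans (ltn_ord j) Nk.
  rewrite (sum_ord_single (F := fun j => p k (p j (w j))) kN).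
    by rewrite (pU _ (proj_in k _)) eqxx.
  by move=> j jk; rewrite (pU _ (proj_in j _)) eq_sym (negPf jk).
rewrite gr_split_coef /= pk -wx.
apply/piece_classP => //; first exact/complement_sub/proj_in.
rewrite -opprB; apply: submodN.
exact: proj_compl (wE k).
Qed.

(* The isomorphism of V[h] onto the Rees module of the filtration, which
   maps u to h^m u for u in U_m. *)
Fact rees_fin (f : vpoly V) : finite_supp (A := fun _ : nat => V)
  (fun k => \sum_(i < k.+1) p i (vcoef f (k - i))).
Proof.
apply: finite_supp_bounded; have [N fN] := vcoef_bounded f.
have [M fM] : exists M, forall i j, (j < N)%N -> (M <= i)%N -> p i (vcoef f j)
  = 0.
  elim: N {fN} => [|N [M IH]]; first by exists 0%N.
  have [M' /filtration_sum [_ M'0 _]] := filtration_nat (vcoef f N).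
  exists (M + M')%N => i j; rewrite ltnS leq_eqVlt => /predU1P [->|jN] MM'.
    by apply: M'0; apply: leq_trans MM'; apply: leq_addl.
  by apply: IH => //; apply: leq_trans MM'; apply: leq_addr.
exists (N + M)%N => k NMk; apply: big1 => i _.
have [Nk|kN] := leqP N (k - i); first by rewrite fN // raddf0.
by apply: fM => //; lia.
Qed.
Definition rees (f : vpoly V) : vpoly V := DSum (rees_fin f).

Lemma vcoef_rees f k :
  vcoef (rees f) k = \sum_(i < k.+1) p i (vcoef f (k - i)).
Proof. by []. Qed.

Lemma rees_linear : linear rees.
Proof.
apply: poly_linearI => [f g|c f|f]; apply: vpolyP => k.
- rewrite vcoefD !vcoef_rees -big_split; apply: eq_bigr => i _.
  by rewrite vcoefD raddfD.
- rewrite vcoefC !vcoef_rees scaler_sumr; apply: eq_bigr => i _.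
  by rewrite vcoefC linearZ.
- rewrite vcoefX vcoef_rees big_ord_recr /= subnn vcoefX raddf0 addr0.
  case: k => [|k]; rewrite ?big_ord0 //; apply: eq_bigr => i _.
  by rewrite vcoefX subSn // -ltnS.
Qed.

Lemma rees_const m u : u \in U m -> rees (vconst u) = 'X^m *: vconst u.
Proof.
move=> Uu; apply: vpolyP => k; rewrite vcoefXn vcoef_rees.
rewrite big_ord_recr big1 => [|i _] /=; last first.
  by rewrite vcoef_const subn_eq0 leqNgt ltn_ord raddf0.
rewrite add0r subnn !vcoef_const /= (pU _ Uu) subn_eq0.
by case: ltngtP.
Qed.

(** The coefficient of [h^(i+j)] is a sum of terms in distinct complements, one of them
    [p i (vcoef f j)]; if it vanishes, so does each term. *)
Lemma rees_inj : injective rees.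
Proof.
move=> f g /eqP; rewrite -subr_eq0 -(linearfB rees_linear) => /eqP fg0.
apply/eqP; rewrite -subr_eq0; apply/eqP; apply: vpolyP => j.
apply: proj_eq0 => i; have := congr1 (fun h => vcoef h (i + j)) fg0.
pose s l := p l (vcoef (f - g) (i + j - l)).
move=> /(@complement_sum_eq0 _ s) s0; rewrite -[j](addKn i).
by apply: s0 => [l|]; [apply: proj_in|rewrite ltnS leq_addr].
Qed.

Lemma vcoef_rees_in f (k : nat) : vcoef (rees f) k \in E k%:Z.
Proof.
apply: rpred_sum => i _; apply: (E_incr _ (complement_sub (proj_in _ _))).
by have := ltn_ord i; lia.
Qed.

(** The preimage moves the component in [U_i] down by i degrees. No component of g is lost this way,
    since the coefficient at [h^k] has components only in degrees at most k. *)
Lemma rees_surj (g : vpoly V) :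
  (forall k : nat, vcoef g k \in E k%:Z) -> exists f, rees f = g.
Proof.
move=> gE; have [N gN] := vcoef_bounded g.
have fin : finite_supp (A := fun _ : nat => V)
    (fun j => \sum_(i < N) p i (vcoef g (i + j))).
  apply: finite_supp_bounded; exists N => j Nj.
  by apply: big1 => i _; rewrite gN ?raddf0 // (leq_trans Nj) ?leq_addl.
exists (DSum fin); apply: vpolyP => k.
rewrite vcoef_rees -[RHS](sum_proj (gE k)).
apply: eq_bigr => i _; rewrite (_ : vcoef _ _ =
  \sum_(j < N) p j (vcoef g (j + (k - i)))) // raddf_sum /=.
have ik : (i + (k - i) = k)%N by rewrite subnKC // -ltnS.
have [Ni|iN] := leqP N i.
  rewrite [in RHS]gN ?raddf0; last by rewrite -ik (leq_trans Ni) ?leq_addr.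
  rewrite big1 // => j _; rewrite proj_proj gtn_eqF //.
  exact: leq_trans (ltn_ord j) Ni.
rewrite (sum_ord_single (F := fun j => p i (p j (vcoef g (j + (k - i)))))
  iN).
  by rewrite proj_proj eqxx ik.
by move=> j ji; rewrite proj_proj eq_sym (negPf ji).
Qed.

(* The preimage of h^m v under the Rees map, for v in E_m. *)
Definition rees_lift (m : nat) (v : V) : vpoly V :=
  \sum_(j < m.+1) 'X^(m - j) *: vconst (p j v).

Lemma rees_liftK m v : v \in E m%:Z -> rees (rees_lift m v) = 'X^m *: vconst v.
Proof.
move=> Ev; rewrite (linearf_sum rees_linear) -{2}(sum_proj Ev) raddf_sum
  scaler_sumr.
apply: eq_bigr => j _; rewrite (linearfZ rees_linear) (rees_const (proj_in _
  _)).
by rewrite scalerA -exprD subnK // -ltnS.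
Qed.

(** Regarding an element of [E_m] as one of [E_(m+1)] costs a factor h. The product formula on gr
    rests on this, as nonnegative modes drop the degree by one. *)
Lemma rees_liftS m v : v \in E m%:Z -> rees_lift m.+1 v = 'X *: rees_lift m v.
Proof.
move=> Ev; have ESv : v \in E m.+1%:Z by apply: E_incr Ev; lia.
apply: rees_inj; rewrite (linearfZ rees_linear) !rees_liftK //.
by rewrite scalerA -exprS.
Qed.

(** Only the component j = m carries no power of h. This is why the lift of v represents the image
    under phi of the class of v. *)
Lemma spec_rees_lift m v :
  spec_class 'X (rees_lift m v) = spec_class 'X (vconst (p m v)).
Proof.
rewrite /rees_lift big_ord_recr subnn scale1r raddfD raddf_sum /=.
rewrite big1 ?add0r // => i _.
by rewrite -(subnSK (ltn_ord i)) exprS -scalerA spec_classMl.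
Qed.

(** * The deformed vertex algebra V[h] and its specializations at h = 1 and h = 0 *)

Variables (Y : V -> int -> V -> V) (vac : V).
Hypothesis YV : vertex_algebra Y vac.
Hypothesis YE : good_filtration Y vac E.

Let M := vpoly_mode YV.
Let Ml r g : linear (fun f => M f r g) := vpoly_mode_linearl YV r g.
Let Mr f r : linear (M f r) := vpoly_mode_linearr YV f r.

(** Chosen as a preimage rather than by the formula for Y_h: it exists since the Rees module is
    stable under modes, and is unique by [rees_inj]. Its properties are then tested after [rees]. *)
Definition deformed_mode (f : vpoly V) (r : int) (g : vpoly V) : vpoly V :=
  xget 0 [set w | rees w = M (rees f) r (rees g)]%classic.

Lemma good_mode (m n : nat) u v (r : int) : u \in E m%:Z -> v \in E n%:Z ->
  Y u r v \in E (m + n)%N%:Z.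
Proof.
move=> Eu Ev; rewrite PoszD; have [r0|r0] := ltP r 0;
  first exact: gf_neg YE _ _ _ _ Eu Ev _ r0.
by apply: E_incr (gf_nneg YE Eu Ev r0); lia.
Qed.

Lemma rees_mode f r g : rees (deformed_mode f r g) = M (rees f) r (rees g).
Proof.
apply: (xgetPex 0 (P := [set w | rees w = M (rees f) r (rees g)]%classic)).
apply: rees_surj => k; rewrite vcoef_mode; apply: rpred_sum => i _.
have -> : k%:Z = (i + (k - i))%N%:Z by have := ltn_ord i; lia.
by apply: good_mode; apply: vcoef_rees_in.
Qed.

(** The coefficient at [h^k] now lies in [E_(k-1)]. At k = 0 it therefore vanishes, and shifting the
    others down by one degree stays in the Rees module. *)
Lemma deformed_mode_nneg f (r : nat) g : exists w, 'X *: w =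
  deformed_mode f r%:Z g.
Proof.
have ME k : vcoef (M (rees f) r%:Z (rees g)) k \in E (k%:Z - 1).
  rewrite vcoef_mode; apply: rpred_sum => i _.
  have -> : k%:Z - 1 = i%:Z + (k - i)%N%:Z - 1 by have := ltn_ord i; lia.
  by apply: (gf_nneg YE) => //; apply: vcoef_rees_in.
have [w ww] : exists w, rees w = vshift (M (rees f) r%:Z (rees g)).
  by apply: rees_surj => k; have := ME k.+1; rewrite intS addrC addKr.
exists w; apply: rees_inj; rewrite rees_mode (linearfZ rees_linear) ww.
rewrite [RHS]vpoly_recl; have /E_neg -> // := ME 0%N.
by rewrite raddf0 add0r.
Qed.

Lemma deformed_mode_linearl r g : linear (fun f => deformed_mode f r g).
Proof.
move=> c f f'; apply: rees_inj.
rewrite rees_linear !rees_mode rees_linear.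
by rewrite (linearfD (Ml _ _)) (linearfZ (Ml _ _)).
Qed.

Lemma deformed_mode_linearr f r : linear (deformed_mode f r).
Proof.
move=> c g g'; apply: rees_inj.
rewrite rees_linear !rees_mode rees_linear.
by rewrite (linearfD (Mr _ _)) (linearfZ (Mr _ _)).
Qed.

Lemma rees_mode_lift m n u v (r : int) : u \in E m%:Z -> v \in E n%:Z ->
  rees (deformed_mode (rees_lift m u) r (rees_lift n v)) =
  'X^(m + n) *: vconst (Y u r v).
Proof.
move=> Eu Ev; rewrite rees_mode !rees_liftK // (linearfZ (Ml _ _)).
by rewrite (linearfZ (Mr _ _)) scalerA -exprD /M vpoly_mode_const.
Qed.

Lemma deformed_mode_lift m n u v (r : int) : u \in E m%:Z -> v \in E n%:Z ->
  deformed_mode (rees_lift m u) r (rees_lift n v) = rees_lift (m + n) (Y u r v).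
Proof.
by move=> Eu Ev; apply: rees_inj;
  rewrite rees_mode_lift // rees_liftK // good_mode.
Qed.

Lemma rees_lift_complement m u : u \in U m -> rees_lift m u = vconst u.
Proof.
by move=> Uu; apply: rees_inj;
  rewrite rees_liftK ?complement_sub // (rees_const Uu).
Qed.

(** As [E_(-1)] vanishes, [U_0] is all of [E_0]; hence [rees] fixes the constant [vac]. *)
Lemma vac_complement : vac \in U 0.
Proof.
have vE := gf_vac YE; have := @sum_proj 0 vac vE; rewrite big_ord1 => <-.
exact: proj_in.
Qed.

(** The prescribed sum is the Rees lift of [Y u r v] in degree m + n, and elements of the
    complements are their own lifts. *)
Lemma deformed_modesP : deformed_modes U p Y deformed_mode.
Proof.
split; [exact: deformed_mode_linearl|exact: deformed_mode_linearr|].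
move=> m n u v Uu Uv r.
rewrite -(rees_lift_complement Uu) -(rees_lift_complement Uv).
by apply: deformed_mode_lift; apply: complement_sub.
Qed.

Lemma deformed_vertex_algebra : vertex_algebra deformed_mode (vconst vac).
Proof.
pose R : {linear vpoly V -> vpoly V} := linear_pack rees_linear.
apply: (vertex_algebra_inj (f := R) rees_mode rees_inj).
- by move=> n v; apply: deformed_mode_linearl.
- by move=> u n; apply: deformed_mode_linearr.
have vacE : rees (vconst vac) = vconst vac.
  by rewrite (rees_const vac_complement) scale1r.
by rewrite [X in vertex_algebra _ X]vacE; apply: vpoly_vertex_algebra.
Qed.

Let DV : vertex_algebra deformed_mode (vconst vac) := deformed_vertex_algebra.

(** At h = 1 the powers of h disappear from the formula for Y_h, and the projections of [Y u r v]
    add up to [Y u r v]. *)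
Lemma deformed_mode_class_mode u r v :
  spec_class ('X - 1) (vconst (Y u r v)) =
  spec_mode (f := 'X - 1) deformed_mode
    (spec_class ('X - 1) (vconst u)) r (spec_class ('X - 1) (vconst v)).
Proof.
rewrite (spec_mode_class _ DV).
elim/complement_ind: u => [u u' IHu IHu'|m u Uu].
  rewrite (linearfD (va_linearl YV _ _)) !vconstD (linearfD
    (deformed_mode_linearl _ _)).
  by rewrite !spec_classD IHu IHu'.
elim/complement_ind: v => [v v' IHv IHv'|n v Uv].
  rewrite (linearfD (va_linearr YV _ _)) !vconstD (linearfD
    (deformed_mode_linearr _ _)).
  by rewrite !spec_classD IHv IHv'.
have [_ _ /(_ m n u v Uu Uv r) ->] := deformed_modesP.
have Yuv : Y u r v \in E (m + n)%N%:Z by apply: good_mode;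
  apply: complement_sub.
rewrite -{1}(sum_proj Yuv) !raddf_sum; apply: eq_bigr => j _.
by rewrite /= spec_classXn.
Qed.

Lemma deformed_va_isomorphism :
  va_isomorphism Y vac (spec_mode (f := 'X - 1) deformed_mode)
    (spec_class ('X - 1) (vconst vac)) (fun v =>
      spec_class ('X - 1) (vconst v)).
Proof.
split=> //; [exact: spec_const_linear|exact: spec_constX1_bij|].
exact: deformed_mode_class_mode.
Qed.

Let T := quot_vpa deformed_mode (vconst vac).
Hypothesis K_pchar0 : [pchar K] =i pred0.

Lemma deformed_quotient_structure : quotient_structure deformed_mode (vconst
  vac) T.
Proof.
apply: (quot_vpa_structure K_pchar0 DV); first exact: vpoly_scaleX_eq0.
by move=> f g r; apply: deformed_mode_nneg.
Qed.

Lemma gr_deformed_isomorphism :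
  exists (S : vpa_data (gr E)) (phi : gr E -> specialize (vpoly V) 'X),
    [/\ gr_structure Y vac S,
        (forall (m : nat) v, v \in E m%:Z ->
           phi (gr_class E m%:Z v) = spec_class 'X (vconst (p m v)))
      & vpa_isomorphism S T phi].
Proof.
have [split' splitK splitK'] := gr_split_bij.
have [const' constK constK'] := spec_constX_bij V.
pose phi (x : gr E) : specialize (vpoly V) 'X :=
  spec_class 'X (vconst (split' x)).
pose phi' (y : specialize (vpoly V) 'X) : gr E := gr_split (const' y).
have phiK : cancel phi phi' by move=> x; rewrite /phi' constK splitK'.
have phi'K : cancel phi' phi by move=> y; rewrite /phi splitK constK'.
have phi_lin : linear phi.
  have split'_lin : linear split'.
    move=> c x y; apply: (can_inj splitK).
    by rewrite gr_split_linear !splitK'.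
  by move=> c x y; rewrite /phi split'_lin spec_const_linear.
have TS := deformed_quotient_structure; have TV := qs_vpa TS.
have phiE (m : nat) v : v \in E m%:Z ->
    phi (gr_class E m%:Z v) = spec_class 'X (vconst (p m v)).
  by move=> Ev; rewrite /phi -(gr_split_proj Ev) splitK.
(* With lifts in place of leading components, the formulas on gr follow from [deformed_mode_lift],
   which holds in V[h] before reduction modulo h. *)
have phi_lift (m : nat) v : v \in E m%:Z ->
    phi (gr_class E m%:Z v) = spec_class 'X (rees_lift m v).
  by move=> Ev; rewrite phiE // spec_rees_lift.
have phi0 n : phi (gr_class E n 0) = 0 by rewrite gr_class0 (linearf0 phi_lin).
have Y0l n v : Y 0 n v = 0 by exact: (linearf0 (va_linearl YV n v)).
have Y0r u n : Y u n 0 = 0 by exact: (linearf0 (va_linearr YV u n)).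
have phi_inj := can_inj phiK.
exists (transport_vpa T phi phi'), phi; split=> //; last first.
  exact: transport_vpa_isomorphism.
split; first exact: transport_vpaP.
- apply: phi_inj; rewrite phi'K phiE; last exact: gf_vac YE.
  by rewrite (pU _ vac_complement) eqxx (qs_one TS).
- move=> m n u v Eu Ev; apply: phi_inj; rewrite phi'K.
  case: m Eu => m Eu; last first.
    by rewrite (E_neg _ Eu) // Y0l !phi0 (linearf0 (vp_linearl TV _)).
  case: n Ev => n Ev; last first.
    by rewrite (E_neg _ Ev) // Y0r !phi0 (linearf0 (vp_linearr TV _)).
  rewrite -PoszD !phi_lift //; last exact: good_mode.
  by rewrite (qs_mul TS) deformed_mode_lift.
- move=> m u Eu; apply: phi_inj; rewrite phi'K.
  case: m Eu => m Eu; last first.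
    by rewrite (E_neg _ Eu) // Y0l !phi0 (linearf0 (vp_der_derivation TV).1).
  have vE := gf_vac YE; rewrite !phi_lift //; last first.
    by rewrite -[m]addn0; apply: good_mode.
  rewrite (qs_der TS) -(rees_lift_complement vac_complement).
  by rewrite deformed_mode_lift // addn0.
- move=> m n u v Eu Ev i; apply: phi_inj; rewrite phi'K.
  case: m Eu => m Eu; last first.
    by rewrite (E_neg _ Eu) // Y0l !phi0 (linearf0 (vl_linearl (vp_lie TV) _
      _)).
  case: n Ev => n Ev; last first.
    by rewrite (E_neg _ Ev) // Y0r !phi0 (linearf0 (vl_linearr (vp_lie TV) _
      _)).
  have i_ge0 : 0 <= i%:Z by [].
  have := gf_nneg YE Eu Ev i_ge0;
    rewrite -PoszD (phi_lift m) // (phi_lift n) //.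
  have := deformed_mode_lift i%:Z Eu Ev; set y := Y u i%:Z v.
  (* In total degree 0 the product lies in [E_(-1)] and is 0. In degree k + 1 it lies in [E_k], so
     by [rees_liftS] its lift in degree k is the required quotient by h. *)
  case: (m + n)%N => [|k] uv Ey.
    rewrite (E_neg _ Ey) // phi0 -(raddf0 (spec_class 'X)).
    apply: (qs_prod TS).
    rewrite uv (E_neg _ Ey) // /rees_lift big_ord1 !raddf0.
    by [].
  have {}Ey : y \in E k%:Z by move: Ey; rewrite intS [1 + _]addrC addrK.
  rewrite (_ : k.+1%:Z - 1 = k%:Z); last by lia.
  by rewrite phi_lift //; apply: (qs_prod TS); rewrite uv rees_liftS.
Qed.

End Filtration.

Theorem proposition5p8 (R : realType) (V : lmodType R[i])
    (Y : V -> int -> V -> V) (vac : V)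
    (E : int -> submodClosed V) (U : nat -> submodClosed V)
    (hV : vertex_algebra Y vac)
    (hE : good_filtration Y vac E)
    (hE_neg : forall n : int, n < 0 -> forall v, v \in E n -> v = 0)
    (hU : forall n : nat, direct_complement (E n%:Z) (E (n%:Z - 1)) (U n)) :
  internal_direct_sum U /\
  forall (p : nat -> {linear V -> V}) (hp : projections U p),
  exists Yh : vpoly V -> int -> vpoly V -> vpoly V,
    deformed_modes U p Y Yh /\
    [/\ vertex_algebra Yh (vconst vac),
        vertex_algebra (spec_mode (f := 'X) Yh) (spec_class 'X (vconst vac))
          /\ va_commutative (spec_mode (f := 'X) Yh),
        vertex_algebra (spec_mode (f := 'X - 1) Yh)
            (spec_class ('X - 1) (vconst vac))
          /\ va_isomorphism Y vac
               (spec_mode (f := 'X - 1) Yh) (spec_class ('X - 1) (vconst vac))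
               (fun v => spec_class ('X - 1) (vconst v))
      & exists (S : vpa_data (gr E)) (T : vpa_data (specialize (vpoly V) 'X))
               (phi : gr E -> specialize (vpoly V) 'X),
          [/\ gr_structure Y vac S,
              quotient_structure Yh (vconst vac) T,
              (forall (m : nat) v, v \in E m%:Z ->
                 phi (gr_class E m%:Z v) = spec_class 'X (vconst (p m v)))
            & vpa_isomorphism S T phi]].
Proof.
have E_exh := gf_exhaustive hE; have E_incr := gf_incr hE.
split=> [|p pU]; first exact: filtration_direct_sum E_exh E_incr hE_neg hU.
have C_pchar0 : [pchar R[i]] =i pred0 by apply: pchar_num.
have DV := deformed_vertex_algebra E_exh E_incr hE_neg hU pU hV hE.
have DX := deformed_mode_nneg E_exh E_incr hE_neg hU pU hV hE.
exists (deformed_mode E_exh E_incr hE_neg hU pU hV).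
split; first exact: deformed_modesP.
split=> //.
- split; first exact: vertex_algebra_specialize.
  by apply: (quot_commutative DV) => f g r; apply: DX.
- split; first exact: vertex_algebra_specialize.
  exact: deformed_va_isomorphism.
have [S [phi [gS phiE phi_iso]]] :=
  gr_deformed_isomorphism E_exh E_incr hE_neg hU pU hV hE C_pchar0.
exists S, (quot_vpa (deformed_mode E_exh E_incr hE_neg hU pU hV) (vconst
  vac)), phi.
by split=> //; apply: deformed_quotient_structure.
Qed.
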